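(* Let $M$ be a $\mathbb{Z}/2$-graded $A$-module on which $t$ acts nilpotently (equivalently, $\tau$ acts nilpotently). Then the map $\begin{pmatrix}\tau & t\\ -t^{p-1} & -\tau\end{pmatrix}\colon M\oplus M\to M\oplus M$ squares to zero, and $M$ has finite flat dimension over $A$ if and only if this map has maximal image. If $\dim_k M<\infty$, this happens if and only if the rank of this map equals $\dim_k M$; otherwise its rank is strictly less than $\dim_k M$.
   Context: Let $k$ be a field of characteristic $p\ge 3$ and $A=k[t,\tau]/(t^p-\tau^2)$, a $\mathbb{Z}/2$-graded commutative algebra with $t$ in even degree and $\tau$ in odd degree; modules are $\mathbb{Z}/2$-graded. A $k$-linear map $f\colon V\to V$ with $f^2=0$ satisfies $\operatorname{Im} f\subseteq\operatorname{Ker} f$; it is said to have maximal image if $\operatorname{Im} f=\operatorname{Ker} f$. *)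

(* Defs.v *)
From HB Require Import structures.
From mathcomp Require Import all_boot all_order all_algebra.
Set Implicit Arguments. Unset Strict Implicit. Unset Printing Implicit Defensive.
Import GRing.Theory.
Local Open Scope ring_scope.

(* A = k[t,tau]/(t^p - tau^2), t even, tau odd.  A Z/2-graded A-module is a
   pair of k-vector spaces (M0, M1) (arbitrary dimension) with
   t acting on each M_i (degree 0) and tau : M0 -> M1, M1 -> M0 (degree 1),
   such that t and tau commute and tau^2 = t^p (A is commutative). *)
Record gmod (k : fieldType) (p : nat) := GMod {
  gm0 : lmodType k;
  gm1 : lmodType k;
  gt0 : {linear gm0 -> gm0};
  gt1 : {linear gm1 -> gm1};
  gtau01 : {linear gm0 -> gm1};
  gtau10 : {linear gm1 -> gm0};
  gtau2_0 : forall x, gtau10 (gtau01 x) = iter p gt0 x;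
  gtau2_1 : forall x, gtau01 (gtau10 x) = iter p gt1 x;
  gcomm_0 : forall x, gtau01 (gt0 x) = gt1 (gtau01 x);
  gcomm_1 : forall x, gtau10 (gt1 x) = gt0 (gtau10 x) }.

Section GDefs.
Variables (k : fieldType) (p : nat).
Local Notation gmod := (gmod k p).

Definition gtot (M : gmod) : lmodType k := (gm0 M * gm1 M)%type.

Definition act_t (M : gmod) (x : gtot M) : gtot M := (gt0 M x.1, gt1 M x.2).
Definition act_tau (M : gmod) (x : gtot M) : gtot M :=
  (gtau10 M x.2, gtau01 M x.1).

Record ghom (M N : gmod) := GHom {
  gh0 : {linear gm0 M -> gm0 N};
  gh1 : {linear gm1 M -> gm1 N};
  ghom_t0 : forall x, gh0 (gt0 M x) = gt0 N (gh0 x);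
  ghom_t1 : forall x, gh1 (gt1 M x) = gt1 N (gh1 x);
  ghom_tau01 : forall x, gh1 (gtau01 M x) = gtau01 N (gh0 x);
  ghom_tau10 : forall x, gh0 (gtau10 M x) = gtau10 N (gh1 x) }.

Definition ghtot (M N : gmod) (f : ghom M N) (x : gtot M) : gtot N :=
  (gh0 f x.1, gh1 f x.2).

(* ---- Tensor product N (x)_A M, as the free k-vector space on N x M
   modulo the bilinearity and A-balancedness relations. A formal
   (finite) sum is a list of (coefficient, (n, m)). ---- *)
Definition fsum (N M : gmod) := seq (k * (gtot N * gtot M)).

Definition fcoef (N M : gmod) (s : fsum N M) (nm : gtot N * gtot M) : k :=
  \sum_(x <- s | x.2 == nm) x.1.

Definition tens_rel (N M : gmod) (r : fsum N M) : Prop :=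
  (exists n n' m, r = [:: (1, (n + n', m)); (-1, (n, m)); (-1, (n', m))])
  \/ (exists n m m', r = [:: (1, (n, m + m')); (-1, (n, m)); (-1, (n, m'))])
  \/ (exists (c : k) n m, r = [:: (1, (c *: n, m)); (- c, (n, m))])
  \/ (exists (c : k) n m, r = [:: (1, (n, c *: m)); (- c, (n, m))])
  \/ (exists n m, r = [:: (1, (act_t n, m)); (-1, (n, act_t m))])
  \/ (exists n m, r = [:: (1, (act_tau n, m)); (-1, (n, act_tau m))]).

Definition tens_zero (N M : gmod) (s : fsum N M) : Prop :=
  exists rs : seq (k * fsum N M),
    (forall r, r \in rs -> tens_rel r.2) /\
    forall nm, fcoef s nm = \sum_(r <- rs) r.1 * fcoef r.2 nm.

Definition tens_map (N1 N2 M : gmod) (f : ghom N1 N2) (s : fsum N1 M)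
  : fsum N2 M := [seq (x.1, (ghtot f x.2.1, x.2.2)) | x <- s].

Definition flat (M : gmod) : Prop :=
  forall (N1 N2 : gmod) (f : ghom N1 N2), injective (ghtot f) ->
  forall s : fsum N1 M, tens_zero (tens_map f s) -> tens_zero s.

Definition fin_flat_dim (M : gmod) : Prop :=
  exists (n : nat) (F : nat -> gmod) (d : forall i, ghom (F i.+1) (F i))
         (e : ghom (F 0%N) M),
    (forall i, flat (F i)) /\
    (forall i, (n < i)%N -> forall x : gtot (F i), x = 0) /\
    (forall y : gtot M, exists x, ghtot e x = y) /\
    (forall x, ghtot e x = 0 <-> exists y, ghtot (d 0%N) y = x) /\
    (forall i (x : gtot (F i.+1)),
        ghtot (d i) x = 0 <-> exists y, ghtot (d i.+1) y = x).

Definition mf (M : gmod) (z : gtot M * gtot M) : gtot M * gtot M :=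
  (act_tau z.1 + act_t z.2,
   - iter p.-1 (@act_t M) z.1 - act_tau z.2).

End GDefs.

Section Dim.
Variables (k : fieldType) (V : lmodType k).

Definition spans (P : V -> Prop) (s : seq V) : Prop :=
  (forall i, (i < size s)%N -> P s`_i) /\
  forall v, P v -> exists c : 'I_(size s) -> k,
      v = \sum_(i < size s) c i *: s`_i.

Definition dimP (P : V -> Prop) (r : nat) : Prop :=
  (exists s, size s = r /\ spans P s) /\ forall s, spans P s -> (r <= size s)%N.

(* f : V -> V (with f o f = 0) has maximal image: Im f = Ker f *)
Definition max_image (f : V -> V) : Prop :=
  forall z, f z = 0 <-> exists w, f w = z.

End Dim.

(* Main.v *)
From HB Require Import structures.
Require Import Defs.
From mathcomp Require Import all_boot all_order all_algebra.
From mathcomp Require Import boolp classical_sets functions.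
Set Implicit Arguments. Unset Strict Implicit. Unset Printing Implicit Defensive.
Import GRing.Theory.
Local Open Scope ring_scope.

(** [H(mf)] is [Tor_i(k, M)] for every [i >= 2], because the minimal resolution
    of [k] over the hypersurface [A] becomes 1-periodic after two steps.

    If [F] is flat, tensoring the inclusion of the ideal [(t, tau)] in [A] with
    [F] shows that [mf] is exact on [F]; a descent along a finite flat
    resolution then gives exactness on [M].

    Conversely, [M] has the resolution [0 -> K -> A (x)_k M -> M -> 0], where
    [K] is free over [k[t]] and [tau] acts on [K] as a matrix factorization
    [T] of [t^p] whose reduction mod [t] is [mf] up to sign and order.  If [mf]
    is exact, a contraction of this reduction extends to a [k[t]]-linear [h]
    with [T h + h T = 1 - t D], where [D] is [A]-linear.
    Multiplication by [t] is homotopic to the action of [t_M], so that [1] is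
    homotopic to [D t_M], hence to [D^n t_M^n] for all [n].  As [t_M] is locally
    nilpotent, [K] is locally a direct summand of the induced module
    [A (x)_k[t] K], which is flat. *)

(** * Linear maps between vector spaces of arbitrary dimension *)

Section LinearSelection.
Variable k : fieldType.
Implicit Types U V : lmodType k.

(** A contraction of the reduction modulo t lifts only to T h + h T = 1 - t D, and this cannot be
    repaired by inverting 1 - t D: t acts injectively on K, and the series of the t^n D^n need not
    terminate on polynomials. The homotopy between t and t_M removes this obstacle by changing the
    error term into D t_M, which iterates to D^n t_M^n and so vanishes on a given element for large
    n. The required n depends on the element; the splitting is therefore local, which is enough for
    flatness because a tensor involves finitely many elements.

    A k[t]-linear g splits the multiplication map from the induced module through the A-linear map
    sending x to g(tau x) + tau (x) g(x), whose composite with multiplication is g tau + tau g. This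
    is why homotopies, rather than A-linear maps, are what has to be constructed.

    No Tor group is formed. Vanishing of tensors is tested by balanced maps into vector spaces, and
    these maps are obtained from one extension principle for linear maps in arbitrary dimension. *)

Definition mklin U V (f : U -> V) (lf : linear f) : {linear U -> V} :=
  HB.pack f (GRing.isLinear.Build k U V *:%R f lf).

Definition linear_rel V U (G : V -> U -> Prop) : Prop :=
  G 0 0 /\ forall a v u v' u', G v u -> G v' u' -> G (a *: v + v') (a *: u + u').

Definition subspace V (Q : V -> Prop) : Prop :=
  Q 0 /\ forall a v w, Q v -> Q w -> Q (a *: v + w).

(** The spaces may have infinite dimension and come without bases, so Zorn's lemma is applied once,
    here. [G0] prescribes values and [L] lists the allowed ones; quotients, retractions and
    generalized inverses follow by suitable choices of the two. A maximal linear graph between them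
    is defined everywhere, since at a missing vector any allowed value can be adjoined. *)
Lemma linear_selection V U (G0 L : V -> U -> Prop) :
  linear_rel G0 -> linear_rel L -> (forall v u, G0 v u -> L v u) ->
  (forall u, G0 0 u -> u = 0) -> (forall v, exists u, L v u) ->
  exists g : {linear V -> U},
    (forall v u, G0 v u -> g v = u) /\ (forall v, L v (g v)).
Proof.
move=> lG0 lL G0L fG0 totL.
pose good (G : V -> U -> Prop) := [/\ linear_rel G, forall u, G 0 u -> u = 0,
  forall v u, G0 v u -> G v u & forall v u, G v u -> L v u].
pose P (A : set (V * U)) := A = set0 \/ good (fun v u => A (v, u)).
have [F FP Ftot|A [PA maxA]] := @Zorn_bigcup _ P.
  have [[X0 [FX0 X0n]]|Fn] := pselect (exists X, F X /\ X <> set0); last first.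
    left; apply/seteqP; split=> // x [X FX Xx].
    by case: Fn; exists X; split=> // X0; rewrite X0 in Xx.
  have gX X : F X -> X <> set0 -> good (fun v u => X (v, u)).
    by move=> FX Xn; case: (FP _ FX).
  have gX' X x : F X -> X x -> good (fun v u => X (v, u)).
    by move=> FX Xx; apply: gX => // X_0; rewrite X_0 in Xx.
  right; split.
  - split; first by exists X0 => //; have [[]] := gX _ FX0 X0n.
    move=> a v u v' u' [X FX Xx] [Y FY Yy].
    have [XY|YX] := Ftot _ _ FX FY.
      exists Y => //; have [[_ lY] _ _ _] := gX' _ _ FY Yy.
      by apply: lY => //; exact: XY.
    exists X => //; have [[_ lX] _ _ _] := gX' _ _ FX Xx.
    by apply: lX => //; exact: YX.
  - by move=> u [X FX Xx]; have [_ + _ _] := gX' _ _ FX Xx; exact.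
  - by move=> v u Gvu; exists X0 => //; have [_ _ + _] := gX _ FX0 X0n; exact.
  - by move=> v u [X FX Xx]; have [_ _ _ +] := gX' _ _ FX Xx; exact.
have gA : good (fun v u => A (v, u)).
  case: PA => // A0; exfalso.
  have : P (fun x : V * U => G0 x.1 x.2) by right; split.
  apply: maxA; rewrite A0; split=> // /(_ (0, 0)); apply.
  by case: lG0.
have [[A00 lA] fA G0A AL] := gA.
have dA v : exists u, A (v, u).
  apply: contrapT => nv; have [u0 Lvu0] := totL v.
  (* The graph [A] enlarged by the line through [(v, u0)]. It stays single-valued: an element over 0
     with nonzero coefficient [c] would express [v] through the domain of [A]. *)
  pose B : set (V * U) :=
    fun x => exists c y, A y /\ x = (c *: v + y.1, c *: u0 + y.2).
  apply: (maxA B).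
    split; first by move=> y Ay; exists 0, y; rewrite !scale0r !add0r; case: y Ay.
    move=> BA; apply: nv; exists u0; apply: BA; exists 1, (0, 0).
    by rewrite !scale1r !addr0.
  right; split.
  - split; first by exists 0, (0, 0); rewrite !scale0r !addr0.
    move=> a v1 u1 v2 u2 [c [[x x'] [Ax [-> ->]]]] [d [[y y'] [Ay [-> ->]]]] /=.
    exists (a * c + d), (a *: x + y, a *: x' + y'); split; first exact: lA.
    by rewrite !scalerDr !scalerDl !scalerA; congr (_, _); rewrite addrACA.
  - move=> u [c [[x x'] [Ax [/esym/eqP]]]] /=.
    rewrite addr_eq0 => /eqP cvx ->.
    have [c0|c0] := eqVneq c 0.
      move: cvx; rewrite c0 !scale0r add0r => /esym/eqP; rewrite oppr_eq0 => /eqP x0.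
      by rewrite x0 in Ax; exact: fA.
    case: nv; exists (- c^-1 *: x' + 0).
    have -> : v = - c^-1 *: x + 0.
      by rewrite addr0 scaleNr -scalerN -cvx scalerA mulVf ?scale1r.
    exact: lA.
  - by move=> w u Gwu; exists 0, (w, u); rewrite !scale0r !add0r; split=> //; exact: G0A.
  - move=> w u [c [[x x'] [Ax [-> ->]]]] /=.
    by case: lL => _; apply => //; exact: AL.
have uA v u u' : A (v, u) -> A (v, u') -> u = u'.
  move=> Au Au'; apply/eqP; rewrite -subr_eq0; apply/eqP; apply: fA.
  have := lA (-1) _ _ _ _ Au' Au.
  by rewrite !scaleN1r addNr addrC.
have [g gP] := choice dA.
have lg : linear g by move=> a x y; apply: (uA _ _ _ (gP _)); exact: lA.
exists (mklin lg); split=> [v u /G0A|v]; first exact: uA.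
exact: AL.
Qed.

(** The quotient by [Q] is modelled inside [V]: [e] selects linearly a representative of each coset,
    with 0 for [Q] itself. No quotient type has to be built. *)
Lemma linear_quotient V (Q : V -> Prop) : subspace Q ->
  exists e : {linear V -> V}, forall v, e v = 0 <-> Q v.
Proof.
move=> [Q0 QD].
have QB v : Q (- v) -> Q v.
  by move=> Qv; have := QD (-1) _ _ Qv Q0; rewrite scaleN1r opprK addr0.
have [||||v|e [eQ Qe]] :=
  @linear_selection V V (fun v u => Q v /\ u = 0) (fun v u => Q (v - u)).
- split=> // a v u v' u' [Qv ->] [Qv' ->]; split; first exact: QD.
  by rewrite scaler0 addr0.
- split=> [|a v u v' u' Q1 Q2]; first by rewrite subr0.
  by have := QD a _ _ Q1 Q2; rewrite scalerBr opprD addrACA.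
- by move=> v u [Qv ->]; rewrite subr0.
- by move=> u [].
- by exists v; rewrite subrr.
exists e => v; split=> [ev|Qv]; last exact: eQ.
by have := Qe v; rewrite ev subr0.
Qed.

Lemma linear_retraction V U (f : {linear U -> V}) : injective f ->
  exists g : {linear V -> U}, cancel f g.
Proof.
move=> injf.
have [||||v|g [gf _]] :=
  @linear_selection V U (fun v u => v = f u) (fun _ _ => True) => //.
- split=> [|a v u v' u' -> ->]; first by rewrite linear0.
  by rewrite linearP.
- by move=> u /esym fu; apply: injf; rewrite fu linear0.
- by exists 0.
by exists g => u; exact: gf.
Qed.

(** Two selections are made. The map [e] normalizes vectors modulo the kernel of [f]; then [f w] can
    be sent to [e w] without ambiguity, and this is extended from the image of [f] to [V]. *)
Lemma linear_regular_inverse U V (f : {linear U -> V}) :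
  exists g : {linear V -> U}, forall u, f (g (f u)) = f u.
Proof.
have [||||v|e [ek fe]] := @linear_selection U U
  (fun u u' => f u = 0 /\ u' = 0) (fun u u' => f u' = f u).
- split=> [|a v u v' u' [fv ->] [fv' ->]]; first by rewrite linear0.
  by rewrite linearP fv fv' !scaler0 !addr0.
- by split=> [|a v u v' u' E1 E2]; rewrite // !linearP E1 E2.
- by move=> v u [-> ->]; rewrite linear0.
- by move=> u [].
- by exists v.
have [||||v|g [gf _]] := @linear_selection V U
  (fun v u => exists2 w, v = f w & u = e w) (fun _ _ => True) => //.
- split=> [|a v u v' u' [w -> ->] [w' -> ->]]; first by exists 0; rewrite linear0.
  by exists (a *: w + w'); rewrite linearP.
- by move=> u [w /esym fw ->]; exact: ek.
- by exists 0.
by exists g => u; rewrite (gf _ (e u)) ?fe //; exists u.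
Qed.

End LinearSelection.

(** * Tensor products and flatness *)

Section Tensor.
Variables (k : fieldType) (p : nat).
Implicit Types N M : gmod k p.

Record balanced N M (W : lmodType k) (phi : gtot N -> gtot M -> W) : Prop := {
  balDl : forall n n' m, phi (n + n') m = phi n m + phi n' m;
  balDr : forall n m m', phi n (m + m') = phi n m + phi n m';
  balZl : forall c n m, phi (c *: n) m = c *: phi n m;
  balZr : forall c n m, phi n (c *: m) = c *: phi n m;
  balt : forall n m, phi (act_t n) m = phi n (act_t m);
  baltau : forall n m, phi (act_tau n) m = phi n (act_tau m) }.

Definition feval N M (W : lmodType k) (phi : gtot N -> gtot M -> W)
    (s : fsum N M) : W :=
  \sum_(x <- s) x.1 *: phi x.2.1 x.2.2.

(** [tens_zero] compares coefficient functions, not lists. Evaluation must therefore be shown to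
    depend on the coefficients alone; [L] is any duplicate-free list containing the support. *)
Lemma feval_fcoef N M (W : lmodType k) (phi : gtot N -> gtot M -> W)
    (s : fsum N M) L : uniq L -> {subset [seq x.2 | x <- s] <= L} ->
  feval phi s = \sum_(nm <- L) fcoef s nm *: phi nm.1 nm.2.
Proof.
move=> uL sL; under [RHS]eq_bigr do rewrite /fcoef scaler_suml big_mkcond.
rewrite exchange_big /= /feval big_seq [RHS]big_seq; apply: eq_bigr => x xs.
rewrite (bigD1_seq x.2) //=; last by apply: sL; apply: map_f.
by rewrite eqxx big1 ?addr0 // => i /negPf; rewrite eq_sym => ->.
Qed.

Lemma feval_rel N M (W : lmodType k) (phi : gtot N -> gtot M -> W) r :
  balanced phi -> tens_rel r -> feval phi r = 0.
Proof.
rewrite /feval => -[Dl Dr Zl Zr bt btau].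
case=> [[n [n' [m ->]]]|[[n [m [m' ->]]]|[[c [n [m ->]]]|[[c [n [m ->]]]|
  [[n [m ->]]|[n [m ->]]]]]]]; rewrite !big_cons big_nil /= ?addr0 ?scaleN1r ?scaleNr.
- by rewrite Dl scale1r addrACA !subrr addr0.
- by rewrite Dr scale1r addrACA !subrr addr0.
- by rewrite Zl scale1r subrr.
- by rewrite Zr scale1r subrr.
- by rewrite bt scale1r subrr.
- by rewrite btau scale1r subrr.
Qed.

Lemma tens_zero_feval N M (W : lmodType k) (phi : gtot N -> gtot M -> W) s :
  balanced phi -> tens_zero s -> feval phi s = 0.
Proof.
move=> bphi [rs [rsP sE]].
pose L := undup ([seq x.2 | x <- s] ++ flatten [seq [seq x.2 | x <- r.2] | r <- rs]).
rewrite (@feval_fcoef _ _ _ _ _ L) ?undup_uniq //; last first.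
  by move=> x xs; rewrite mem_undup mem_cat xs.
under eq_bigr do rewrite sE scaler_suml.
rewrite exchange_big big_seq big1 //= => r rrs.
under eq_bigr do rewrite -scalerA.
rewrite -scaler_sumr -feval_fcoef ?undup_uniq //.
  by rewrite feval_rel ?scaler0 //; exact: rsP.
move=> x xr; rewrite mem_undup mem_cat; apply/orP; right.
by apply/flattenP; exists [seq x.2 | x <- r.2] => //; apply/mapP; exists r.
Qed.

(** A vector space that detects vanishing tensors: all functions on pairs, modulo the span [Q] of
    the relations. Functions of infinite support do no harm, as only the values of [e] on finite
    sums are used. *)
Lemma tensor_exists N M : exists (W : lmodType k) (tp : gtot N -> gtot M -> W),
  balanced tp /\ forall s, tens_zero s <-> feval tp s = 0.
Proof.
pose W : lmodType k := (gtot N * gtot M -> k^o).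
pose Q (F : W) := exists rs : seq (k * fsum N M),
  (forall r, r \in rs -> tens_rel r.2) /\
  forall nm, F nm = \sum_(r <- rs) r.1 * fcoef r.2 nm.
have sQ : subspace Q.
  split; first by exists [::]; split=> // nm; rewrite big_nil.
  move=> a v w [rs [rsP vE]] [rs' [rsP' wE]].
  exists ([seq (a * r.1, r.2) | r <- rs] ++ rs'); split.
    move=> r; rewrite mem_cat => /orP[/mapP[r' r'rs ->]|rrs'].
      exact: (rsP r').
    exact: rsP'.
  move=> nm; rewrite big_cat big_map /= -wE; congr (_ + _).
  transitivity (a * v nm) => //; rewrite vE mulr_sumr.
  by apply: eq_bigr => r _; rewrite mulrA.
have [e eP] := linear_quotient sQ.
pose delta n m : W := fcoef [:: (1, (n, m))].
have fcoefE (s : fsum N M) : (fcoef s : W) = feval delta s.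
  apply/funext => nm; rewrite /feval fct_sumE /fcoef big_mkcond /=.
  apply: eq_bigr => -[c [n m]] _ /=; rewrite /delta /fcoef scalrfctE big_cons big_nil /=.
  by case: ifP => _; rewrite ?scaler0 // addr0 [_ *: _]mulr1.
have erel r : tens_rel r -> e (feval delta r) = 0.
  move=> rr; apply/eP; exists [:: (1, r)]; split=> [r'|nm].
    by rewrite inE => /eqP ->.
  by rewrite big_cons big_nil mul1r addr0 -fcoefE.
exists W, (fun n m => e (delta n m)); split; last first.
  move=> s; have -> : feval (fun n m => e (delta n m)) s = e (feval delta s).
    by rewrite linear_sum; apply: eq_bigr => x _; rewrite linearZ.
  by rewrite -fcoefE; apply: iff_sym; exact: eP.
rewrite /tens_rel in erel; split.
- move=> n n' m; apply/eqP; rewrite -subr_eq0; apply/eqP.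
  rewrite -[RHS](erel [:: (1, (n + n', m)); (-1, (n, m)); (-1, (n', m))]); last by left; exists n, n', m.
  by rewrite /feval !big_cons big_nil /= addr0 !scaleN1r scale1r -opprD (linearB e) (linearD e).
- move=> n m m'; apply/eqP; rewrite -subr_eq0; apply/eqP.
  rewrite -[RHS](erel [:: (1, (n, m + m')); (-1, (n, m)); (-1, (n, m'))]); last by right; left; exists n, m, m'.
  by rewrite /feval !big_cons big_nil /= addr0 !scaleN1r scale1r -opprD (linearB e) (linearD e).
- move=> c n m; apply/eqP; rewrite -subr_eq0; apply/eqP.
  rewrite -[RHS](erel [:: (1, (c *: n, m)); (- c, (n, m))]); last by do 2 right; left; exists c, n, m.
  by rewrite /feval !big_cons big_nil /= addr0 scaleNr scale1r (linearB e) (linearZ_LR e).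
- move=> c n m; apply/eqP; rewrite -subr_eq0; apply/eqP.
  rewrite -[RHS](erel [:: (1, (n, c *: m)); (- c, (n, m))]); last by do 3 right; left; exists c, n, m.
  by rewrite /feval !big_cons big_nil /= addr0 scaleNr scale1r (linearB e) (linearZ_LR e).
- move=> n m; apply/eqP; rewrite -subr_eq0; apply/eqP.
  rewrite -[RHS](erel [:: (1, (act_t n, m)); (-1, (n, act_t m))]); last by do 4 right; left; exists n, m.
  by rewrite /feval !big_cons big_nil /= addr0 scaleN1r scale1r (linearB e).
- move=> n m; apply/eqP; rewrite -subr_eq0; apply/eqP.
  rewrite -[RHS](erel [:: (1, (act_tau n, m)); (-1, (n, act_tau m))]); last by do 5 right; exists n, m.
  by rewrite /feval !big_cons big_nil /= addr0 scaleN1r scale1r (linearB e).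
Qed.

Lemma ghtot_linear N M (f : ghom N M) : linear (ghtot f).
Proof. by move=> a x y; rewrite /ghtot /= !linearP. Qed.

Lemma ghtot_act_t N M (f : ghom N M) x : ghtot f (act_t x) = act_t (ghtot f x).
Proof. by rewrite /ghtot /act_t /= ghom_t0 ghom_t1. Qed.

Lemma ghtot_act_tau N M (f : ghom N M) x :
  ghtot f (act_tau x) = act_tau (ghtot f x).
Proof. by rewrite /ghtot /act_tau /= ghom_tau01 ghom_tau10. Qed.

Lemma act_t_linear M : linear (@act_t k p M).
Proof. by move=> a x y; rewrite /act_t /= !linearP. Qed.

Lemma act_tau_linear M : linear (@act_tau k p M).
Proof. by move=> a x y; rewrite /act_tau /= !linearP. Qed.

HB.instance Definition _ N M (f : ghom N M) := GRing.isLinear.Build k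
  (gtot N) (gtot M) *:%R (ghtot f) (ghtot_linear f).
HB.instance Definition _ M := GRing.isLinear.Build k
  (gtot M) (gtot M) *:%R (@act_t k p M) (@act_t_linear M).
HB.instance Definition _ M := GRing.isLinear.Build k
  (gtot M) (gtot M) *:%R (@act_tau k p M) (@act_tau_linear M).

Lemma tens_zero_mapr N M M' (g : ghom M M') (s : fsum N M) : tens_zero s ->
  tens_zero [seq (x.1, (x.2.1, ghtot g x.2.2)) | x <- s].
Proof.
have [W [tp [btp tpP]]] := tensor_exists N M'; rewrite tpP => s0.
rewrite /feval big_map /=.
apply: (tens_zero_feval (phi := fun n m => tp n (ghtot g m)) _ s0).
case: btp => Dl Dr Zl Zr bt btau; split=> *; rewrite ?Dl ?Zl //.
- by rewrite linearD Dr.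
- by rewrite linearZ_LR Zr.
- by rewrite ghtot_act_t bt.
- by rewrite ghtot_act_tau btau.
Qed.

(* Only finitely many elements of [K] occur in a given tensor, so a retraction
   that depends on these elements is enough. *)
Lemma flat_local_retract (K P : gmod k p) (mu : ghom P K) (sigma : nat -> ghom K P) :
  flat P ->
  (forall x, exists n0, forall n, (n0 <= n)%N -> ghtot mu (ghtot (sigma n) x) = x) ->
  flat K.
Proof.
move=> fP retr N1 N2 f injf s s0.
have [n sn] : exists n, forall x, x \in s -> ghtot mu (ghtot (sigma n) x.2.2) = x.2.2.
  suff [n0 sn] : exists n0, forall n, (n0 <= n)%N ->
      forall x, x \in s -> ghtot mu (ghtot (sigma n) x.2.2) = x.2.2.
    by exists n0; exact: sn.
  elim: (s) => [|x s' [n0 IH]]; first by exists 0%N.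
  have [n1 n1P] := retr x.2.2; exists (maxn n0 n1) => n.
  rewrite geq_max => /andP[le0 le1] y; rewrite inE => /orP[/eqP ->|ys].
    exact: n1P.
  exact: IH.
have /(tens_zero_mapr (sigma n)) := s0; rewrite /tens_map -map_comp => s1.
have {}s1 : tens_zero [seq (x.1, (x.2.1, ghtot (sigma n) x.2.2)) | x <- s].
  by apply: (fP _ _ f injf); rewrite /tens_map -map_comp; exact: s1.
have := tens_zero_mapr mu s1; rewrite -map_comp.
rewrite (_ : map _ s = s) // -[RHS]map_id; apply/eq_in_map => -[c [a b]] xs /=.
by have /= -> := sn _ xs.
Qed.

End Tensor.

Section LinearIter.
Variable k : fieldType.
Implicit Types U V : lmodType k.

Lemma iter_linear U (f : {linear U -> U}) n : linear (iter n f).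
Proof. by elim: n => [|n IH] a x y //=; rewrite IH linearP. Qed.

HB.instance Definition _ n U (f : {linear U -> U}) := GRing.isLinear.Build k
  U U *:%R (iter n f) (@iter_linear U f n).

Lemma iter_intertwine U V (f : U -> U) (g : V -> V) (h : U -> V) n :
  (forall x, h (f x) = g (h x)) -> forall x, h (iter n f x) = iter n g (h x).
Proof. by move=> fg; elim: n => //= n IH x; rewrite fg IH. Qed.

Lemma iter_eq0_le U (f : {linear U -> U}) m n x :
  iter m f x = 0 -> (m <= n)%N -> iter n f x = 0.
Proof. by move=> fx mn; rewrite -(subnK mn) iterD fx linear0. Qed.

End LinearIter.

(** * Exactness on modules of finite flat dimension *)

Section MatrixFactorization.
Variables (k : fieldType) (p : nat).
Implicit Types M : gmod k p.

Lemma iter_act_t M n (x : gtot M) :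
  iter n (@act_t k p M) x = (iter n (gt0 M) x.1, iter n (gt1 M) x.2).
Proof. by elim: n => [|n /= ->] //; case: x. Qed.

Lemma act_tau2 M (x : gtot M) : act_tau (act_tau x) = iter p (@act_t k p M) x.
Proof. by rewrite /act_tau /= gtau2_0 gtau2_1 iter_act_t. Qed.

Lemma act_tau_t M (x : gtot M) : act_tau (act_t x) = act_t (act_tau x).
Proof. by rewrite /act_tau /act_t /= gcomm_0 gcomm_1. Qed.

Lemma act_tau_iter M n (x : gtot M) :
  act_tau (iter n (@act_t k p M) x) = iter n (@act_t k p M) (act_tau x).
Proof. by apply: iter_intertwine; exact: act_tau_t. Qed.

Lemma mf_linear M : linear (@mf k p M).
Proof.
move=> a x y; rewrite /mf /= !linearP /=; congr (_, _);
  by rewrite /= scalerDr addrACA.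
Qed.

HB.instance Definition _ M := GRing.isLinear.Build k (gtot M * gtot M)%type
  (gtot M * gtot M)%type *:%R (@mf k p M) (@mf_linear M).

Lemma mf_mf M : (0 < p)%N -> forall z, mf (mf z) = 0 :> gtot M * gtot M.
Proof.
move=> p0 [x y]; rewrite /mf /=.
have tE z : act_t (iter p.-1 (@act_t k p M) z) = iter p (@act_t k p M) z.
  by rewrite -iterS prednK.
have tE' z : iter p.-1 (@act_t k p M) (act_t z) = iter p (@act_t k p M) z.
  by rewrite -iterSr prednK.
rewrite !linearD !linearN /=.
rewrite !act_tau2 tE tE' -!act_tau_t act_tau_iter.
congr (_, _); first by rewrite -opprD subrr.
by rewrite -!opprD subrr oppr0.
Qed.

Lemma ghtot_iter M N (f : ghom M N) n x :
  ghtot f (iter n (@act_t k p M) x) = iter n (@act_t k p N) (ghtot f x).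
Proof. by apply: iter_intertwine; exact: ghtot_act_t. Qed.

Definition ghtot2 M N (f : ghom M N) (z : gtot M * gtot M) : gtot N * gtot N :=
  (ghtot f z.1, ghtot f z.2).

Lemma mf_ghtot2 M N (f : ghom M N) z : mf (ghtot2 f z) = ghtot2 f (mf z).
Proof.
rewrite /ghtot2 /mf /= linearD linearB linearN /=.
by rewrite ghtot_iter !ghtot_act_tau ghtot_act_t.
Qed.

End MatrixFactorization.

(** * Tensoring the ideal (t, tau) with a flat module *)

Section FlatSyzygy.
Variables (k : fieldType) (p : nat).

Lemma mulXn_linear n : linear (fun f : {poly k} => 'X^n * f).
Proof. by move=> a f g; rewrite mulrDr scalerAr. Qed.

Definition mulXn n : {linear {poly k} -> {poly k}} := mklin (mulXn_linear n).

Lemma iter_mulX n f : iter n (mulXn 1) f = 'X^n * f.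
Proof.
elim: n => [|n IH] /=; first by rewrite mul1r.
by rewrite IH mulrA expr1 exprS.
Qed.

(* The fractional ideals of A: [(0, p)] is A itself, and [(1, p - 1)] is the
   ideal (t, tau), with [(f, g)] standing for [t f + tau g]. *)
Definition rank1 i j (ij : (i + j = p)%N) : gmod k p.
Proof.
exists ({poly k} : lmodType k) ({poly k} : lmodType k)
  (mulXn 1) (mulXn 1) (mulXn i) (mulXn j).
- by move=> f /=; rewrite iter_mulX mulrA -exprD addnC ij.
- by move=> f /=; rewrite iter_mulX mulrA -exprD ij.
- by move=> f /=; rewrite mulrCA.
- by move=> f /=; rewrite mulrCA.
Defined.

Definition rank1_incl j (ij : (1 + j = p)%N) : ghom (rank1 ij) (rank1 (add0n p)).
Proof.
exists (mulXn 1) (mulXn 0); rewrite //=.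
- by move=> f; rewrite mulrCA.
- by move=> f; rewrite mulrA -exprD ij mul1r.
Defined.

Lemma rank1_incl_inj j (ij : (1 + j = p)%N) : injective (ghtot (rank1_incl ij)).
Proof.
move=> [f g] [f' g'] [] /= E; rewrite !mul1r => ->; congr (_, _).
apply: (mulfI _ E); exact: monic_neq0 (monicXn _ _).
Qed.

Variable F : gmod k p.

Definition pact (f : {poly k}) (z : gtot F) : gtot F :=
  \sum_(i < size f) f`_i *: iter i (@act_t k p F) z.

Lemma pactE n (f : {poly k}) z : (size f <= n)%N ->
  pact f z = \sum_(i < n) f`_i *: iter i (@act_t k p F) z.
Proof.
move=> sn; rewrite /pact (big_ord_widen n (fun i => f`_i *: iter i (@act_t k p F) z) sn) big_mkcond /=.
by apply: eq_bigr => i _; case: ltnP => // /(nth_default 0) ->; rewrite scale0r.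
Qed.

Lemma pact_linear z : linear (pact^~ z).
Proof.
move=> a f g; pose n := maxn (size f) (size g).
rewrite !(@pactE n) ?leq_maxl ?leq_maxr //; last first.
  by rewrite (leq_trans (size_polyD _ _)) // geq_max leq_maxr (leq_trans (size_scale_leq _ _)) ?leq_maxl.
rewrite scaler_sumr -big_split /=; apply: eq_bigr => i _.
by rewrite coefD coefZ scalerDl scalerA.
Qed.

Lemma pact_linearr f : linear (pact f).
Proof.
move=> a x y; rewrite /pact scaler_sumr -big_split /=; apply: eq_bigr => i _.
by rewrite iter_linear scalerDr !scalerA mulrC.
Qed.

Lemma pact1 z : pact 1 z = z.
Proof. by rewrite /pact size_poly1 big_ord1 coef1 scale1r. Qed.

Lemma pact_X f z : pact ('X * f) z = act_t (pact f z).
Proof.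
rewrite (@pactE (size f).+1); last by rewrite (leq_trans (size_polyMleq _ _)) // size_polyX.
rewrite big_ord_recl coefXM scale0r add0r [RHS]linear_sum.
by apply: eq_bigr => i _; rewrite linearZ_LR coefXM.
Qed.

Lemma pact_Xn n f z : pact ('X^n * f) z = iter n (@act_t k p F) (pact f z).
Proof.
elim: n => [|n IH]; first by rewrite mul1r.
by rewrite exprS -mulrA pact_X IH.
Qed.

Lemma pact_act_t f z : pact f (act_t z) = act_t (pact f z).
Proof.
rewrite [RHS]linear_sum; apply: eq_bigr => i _.
by rewrite linearZ_LR /= -iterSr.
Qed.

Lemma pact_act_tau f z : pact f (act_tau z) = act_tau (pact f z).
Proof.
rewrite [RHS]linear_sum; apply: eq_bigr => i _.
by rewrite linearZ_LR /= act_tau_iter.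
Qed.

(** The tensor tau (x) x + t (x) y of the ideal with [F] becomes 1 (x) (tau x + t y) = 0 over A, so
    flatness makes it zero already over the ideal. A balanced map sends it to the class of [(x, y)]
    modulo the image of [mf], and this class must then vanish. *)
Lemma flat_syzygy : flat F -> (0 < p)%N -> forall x y : gtot F,
  act_tau x + act_t y = 0 -> exists w, mf w = (x, y).
Proof.
move=> flF p0 x y xy; have ij : (1 + p.-1 = p)%N by rewrite add1n prednK.
pose I := rank1 ij.
have [|e eP] := @linear_quotient k (gtot F * gtot F)%type (fun z => exists w, mf w = z).
  split=> [|a v w [v' <-] [w' <-]]; first by exists 0; exact: linear0.
  by exists (a *: v' + w'); exact: linearP.
(* The ideal element t f + tau g paired with z gives (g z, f z). The two sides of the tau-relation
   differ by [mf] of (g z, - f z), which is why the values are taken modulo the image of [mf]. *)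
pose phi (a : gtot I) (z : gtot F) := e (pact a.2 z, pact a.1 z).
have bphi : balanced phi.
  split.
  - move=> [f g] [f' g'] z; rewrite /phi /= -(linearD e); congr (e (_, _));
      exact: (linearD (mklin (pact_linear z))).
  - move=> [f g] z z'; rewrite /phi /= -(linearD e); congr (e (_, _));
      exact: (linearD (mklin (pact_linearr _))).
  - move=> c [f g] z; rewrite /phi /= -(linearZ_LR e); congr (e (_, _));
      exact: (linearZ_LR (mklin (pact_linear z))).
  - move=> c [f g] z; rewrite /phi /= -(linearZ_LR e); congr (e (_, _));
      exact: (linearZ_LR (mklin (pact_linearr _))).
  - by move=> [f g] z; rewrite /phi /= !pact_X !pact_act_t.
  - move=> [f g] z; rewrite /phi /=; apply/esym/eqP; rewrite -subr_eq0 -(linearB e).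
    apply/eqP/eP; exists (pact g z, - pact f z); rewrite /mf /=.
    rewrite pact_X pact_Xn !pact_act_tau linearN linearN /= opprK.
    by congr (_, _); rewrite addrC.
pose s : fsum I F := [:: (1, ((0, 1), x)); (1, ((1, 0), y))].
have : tens_zero s.
  apply: (flF _ _ (rank1_incl ij) (@rank1_incl_inj _ ij)).
  set A := rank1 (add0n p).
  have [W [tp [[Dl Dr Zl Zr bt btau] tpP]]] := tensor_exists A F.
  apply/tpP; rewrite /feval !big_cons big_nil !scale1r addr0 /=.
  have -> : ghtot (rank1_incl ij) (0, 1) = act_tau ((1, 0) : gtot A).
    by rewrite /ghtot /act_tau /= !mulr0.
  have -> : ghtot (rank1_incl ij) (1, 0) = act_t ((1, 0) : gtot A).
    by rewrite /ghtot /act_t /= !mulr0.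
  by rewrite bt btau -Dr xy; have := Zr 0 (1, 0) 0; rewrite !scale0r.
move=> /(tens_zero_feval bphi); rewrite /feval !big_cons big_nil !scale1r addr0 /phi /=.
rewrite -(linearD e) !pact1 => /eP.
have p00 z : pact 0 z = 0 by exact: (linear0 (mklin (pact_linear z))).
by rewrite !p00 => -[w wE]; exists w; rewrite wE; congr (_, _); rewrite /= ?addr0 ?add0r.
Qed.

End FlatSyzygy.

Section FiniteFlatDimension.
Variables (k : fieldType) (p : nat).
Hypothesis p_gt0 : (0 < p)%N.

Lemma flat_max_image (F : gmod k p) : flat F -> max_image (@mf k p F).
Proof.
move=> flF [x y]; split=> [/(congr1 fst) xy|[w <-]]; last exact: mf_mf.
exact: (flat_syzygy flF p_gt0 xy).
Qed.

(* Acyclicity descends along the resolution: at each stage the submodule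
   [B] = image of the next differential is already known to be acyclic. *)
Lemma acyclic_image (F M : gmod k p) (f : ghom F M)
    (B : gtot F -> Prop) :
  flat F -> (forall x, ghtot f x = 0 <-> B x) ->
  (forall z, B z.1 -> B z.2 -> mf z = 0 ->
     exists w, [/\ B w.1, B w.2 & mf w = z]) ->
  forall y, mf (ghtot2 f y) = 0 -> exists w, mf (ghtot2 f w) = ghtot2 f y.
Proof.
move=> flF fB acB y; rewrite mf_ghtot2 => E.
have /fB f1 : ghtot f (mf y).1 = 0 := congr1 fst E.
have /fB f2 : ghtot f (mf y).2 = 0 := congr1 snd E.
have [w [Bw1 Bw2 wy]] := acB _ f1 f2 (mf_mf p_gt0 y).
have /(flat_max_image flF) [v vE] : mf (y - w) = 0.
  by rewrite linearB /= wy subrr.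
exists v; rewrite mf_ghtot2 vE /ghtot2 /= !linearB /=.
by move/fB: Bw1 => ->; move/fB: Bw2 => ->; rewrite !subr0.
Qed.

Lemma fin_flat_dim_max_image (M : gmod k p) :
  fin_flat_dim M -> max_image (@mf k p M).
Proof.
move=> [n [F [d [e [flF [F0 [se [exe exd]]]]]]]].
pose B i (x : gtot (F i)) := exists y, ghtot (d i) y = x.
pose acyc i := forall z, B i z.1 -> B i z.2 -> mf z = 0 ->
  exists w, [/\ B i w.1, B i w.2 & mf w = z].
(* The descent starts where the image of the differential is zero, because its source [F n.+1]
   vanishes. *)
have acn : acyc n.
  move=> [x1 x2] /= [y1 <-] [y2 <-] _.
  rewrite (F0 n.+1 (ltnSn n) y1) (F0 n.+1 (ltnSn n) y2).
  exists 0; have -> : ghtot (d n) 0 = 0 := linear0 _.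
  by split; [exists 0; exact: linear0..|exact: linear0].
have acS i : acyc i.+1 -> acyc i.
  move=> ac [x1 x2] /= [y1 <-] [y2 <-] z0.
  have [w wE] := acyclic_image (flF _) (exd i) ac (y := (y1, y2)) z0.
  by exists (ghtot2 (d i) w); split=> //; [exists w.1|exists w.2].
have ac0 : acyc 0%N by elim: n acn {F0} => // n IH /acS.
move=> [x1 x2]; split=> [z0|[w <-]]; last exact: mf_mf.
have [y1 y1E] := se x1; have [y2 y2E] := se x2.
have [|w wE] := acyclic_image (flF _) exe ac0 (y := (y1, y2)).
  by rewrite /ghtot2 /= y1E y2E.
by exists (ghtot2 e w); rewrite wE /ghtot2 /= y1E y2E.
Qed.

End FiniteFlatDimension.

(** * Polynomials with coefficients in a vector space *)

Section ModulePolynomials.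
Variable k : fieldType.
Implicit Types U V W : lmodType k.

Definition finsupp U : pred (nat -> U) :=
  fun f => `[< exists n, forall i, (n <= i)%N -> f i = 0 >].

Lemma finsupp_submod_closed U : submod_closed (@finsupp U).
Proof.
split=> [|a f g /asboolP[n fn] /asboolP[m gm]]; apply/asboolP; first by exists 0%N.
exists (maxn n m) => i; rewrite geq_max => /andP[ni mi].
by rewrite -[LHS]/(a *: f i + g i) fn // gm // scaler0 addr0.
Qed.

HB.instance Definition _ U :=
  GRing.isSubmodClosed.Build k (nat -> U) (@finsupp U) (@finsupp_submod_closed U).

(* [U[t]], the polynomials in [t] with coefficients in the module [U]. *)
Record pol U := Pol { pcoef : nat -> U; _ : pcoef \in @finsupp U }.

HB.instance Definition _ U := [isSub of pol U for @pcoef U].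
HB.instance Definition _ U := [Choice of pol U by <:].
HB.instance Definition _ U := [SubChoice_isSubLmodule of pol U by <:].

Lemma polP U (a b : pol U) : (forall i, pcoef a i = pcoef b i) -> a = b.
Proof. by move=> ab; apply: val_inj; apply/funext. Qed.

Lemma pol_bounded U (a : pol U) : exists n, forall i, (n <= i)%N -> pcoef a i = 0.
Proof. by case: a => f fP; exact: (elimT (asboolP _) fP). Qed.

Lemma pcoefD U (a b : pol U) i : pcoef (a + b) i = pcoef a i + pcoef b i.
Proof. by []. Qed.

Lemma pcoefZ U c (a : pol U) i : pcoef (c *: a) i = c *: pcoef a i.
Proof. by []. Qed.

Definition mkpol U (f : nat -> U)
    (fP : exists n, forall i, (n <= i)%N -> f i = 0) : pol U :=
  Pol (introT (asboolP _) fP : f \in @finsupp U).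

Lemma pX_subproof U (a : pol U) :
  exists n, forall i, (n <= i)%N -> (if i is j.+1 then pcoef a j else 0) = 0.
Proof. by have [n an] := pol_bounded a; exists n.+1 => -[|i] //; exact: an. Qed.

Definition pX U (a : pol U) : pol U := mkpol (pX_subproof a).

Lemma pdown_subproof U (a : pol U) :
  exists n, forall i, (n <= i)%N -> pcoef a i.+1 = 0.
Proof. by have [n an] := pol_bounded a; exists n => i ni; apply: an; exact: leqW. Qed.

Definition pdown U (a : pol U) : pol U := mkpol (pdown_subproof a).

Lemma pC_subproof U (u : U) :
  exists n, forall i, (n <= i)%N -> (if i is j.+1 then 0 else u) = 0.
Proof. by exists 1%N => -[]. Qed.

Definition pC U (u : U) : pol U := mkpol (pC_subproof u).

Lemma polmap_subproof U V (f : {linear U -> V}) (a : pol U) :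
  exists n, forall i, (n <= i)%N -> f (pcoef a i) = 0.
Proof. by have [n an] := pol_bounded a; exists n => i ni; rewrite an ?linear0. Qed.

Definition polmap U V (f : {linear U -> V}) (a : pol U) : pol V :=
  mkpol (polmap_subproof f a).

Lemma pX_linear U : linear (@pX U).
Proof. by move=> c a b; apply: polP => -[|i]; rewrite pcoefD pcoefZ //= scaler0 addr0. Qed.
HB.instance Definition _ U := GRing.isLinear.Build k (pol U) (pol U) *:%R
  (@pX U) (@pX_linear U).

Lemma pdown_linear U : linear (@pdown U).
Proof. by move=> c a b; apply: polP. Qed.
HB.instance Definition _ U := GRing.isLinear.Build k (pol U) (pol U) *:%R
  (@pdown U) (@pdown_linear U).

Lemma pC_linear U : linear (@pC U).
Proof. by move=> c a b; apply: polP => -[|i]; rewrite pcoefD pcoefZ //= scaler0 addr0. Qed.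
HB.instance Definition _ U := GRing.isLinear.Build k U (pol U) *:%R
  (@pC U) (@pC_linear U).

Lemma polmap_linear U V (f : {linear U -> V}) : linear (polmap f).
Proof. by move=> c a b; apply: polP => i; exact: linearP. Qed.
HB.instance Definition _ U V (f : {linear U -> V}) := GRing.isLinear.Build k
  (pol U) (pol V) *:%R (polmap f) (polmap_linear f).

Lemma pX_inj U : injective (@pX U).
Proof.
by move=> a b ab; apply: polP => i; have := congr1 (fun c => pcoef c i.+1) ab.
Qed.

Lemma pX_pdown U (a : pol U) : pcoef a 0 = 0 -> pX (pdown a) = a.
Proof. by move=> a0; apply: polP => -[|i]. Qed.

Lemma pol_decomp U (a : pol U) : a = pC (pcoef a 0) + pX (pdown a).
Proof. by apply: polP => -[|i]; rewrite pcoefD /= ?addr0 ?add0r. Qed.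

Lemma polmap_X U V (f : {linear U -> V}) a : polmap f (pX a) = pX (polmap f a).
Proof. by apply: polP => -[|i] //=; rewrite linear0. Qed.

Lemma polmap_C U V (f : {linear U -> V}) u : polmap f (pC u) = pC (f u).
Proof. by apply: polP => -[|i] //=; rewrite linear0. Qed.

Lemma pol_ind' U (P : pol U -> Prop) : P 0 ->
  (forall u a, P a -> P (pC u + pX a)) -> forall a, P a.
Proof.
move=> P0 PS a; have [n] := pol_bounded a.
elim: n a => [|n IH] a an.
  by rewrite (_ : a = 0) //; apply: polP => i; exact: an.
by rewrite (pol_decomp a); apply: PS; apply: IH => i ni; exact: an.
Qed.

Definition pbound U (a : pol U) : nat := sval (cid (pol_bounded a)).

(** The universal property of U[t] as the direct sum of the t^i U: the components [phi] are
    arbitrary. The bound is an unspecified choice, and [psumE] shows that any other bound gives the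
    same value. *)
Definition psum U W (phi : nat -> {linear U -> W}) (a : pol U) : W :=
  \sum_(i < pbound a) phi i (pcoef a i).

Lemma psumE U W (phi : nat -> {linear U -> W}) a n :
  (forall i, (n <= i)%N -> pcoef a i = 0) ->
  psum phi a = \sum_(i < n) phi i (pcoef a i).
Proof.
have wd m m' : (m <= m')%N -> (forall i, (m <= i)%N -> pcoef a i = 0) ->
    \sum_(i < m) phi i (pcoef a i) = \sum_(i < m') phi i (pcoef a i).
  move=> mm' am; rewrite (big_ord_widen m' (fun i => phi i (pcoef a i)) mm') big_mkcond /=.
  by apply: eq_bigr => i _; case: ltnP => // /am ->; rewrite linear0.
move=> an; rewrite /psum /pbound; case: cid => m am /=.
by rewrite (wd m (maxn m n)) ?leq_maxl // -(wd n) ?leq_maxr.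
Qed.

Lemma psum_linear U W (phi : nat -> {linear U -> W}) : linear (psum phi).
Proof.
move=> c a b; have [n an] := pol_bounded a; have [m bm] := pol_bounded b.
have an' i : (maxn n m <= i)%N -> pcoef a i = 0 by rewrite geq_max => /andP[/an].
have bm' i : (maxn n m <= i)%N -> pcoef b i = 0 by rewrite geq_max => /andP[_ /bm].
rewrite !(@psumE _ _ _ _ (maxn n m)) //; last first.
  by move=> i ni; rewrite pcoefD pcoefZ an' // bm' // scaler0 addr0.
rewrite scaler_sumr -big_split; apply: eq_bigr => i _.
by rewrite pcoefD pcoefZ linearP.
Qed.
HB.instance Definition _ U W phi := GRing.isLinear.Build k
  (pol U) W *:%R (@psum U W phi) (psum_linear phi).

Lemma psum_C U W (phi : nat -> {linear U -> W}) u : psum phi (pC u) = phi 0%N u.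
Proof. by rewrite (@psumE _ _ _ _ 1) ?big_ord1 // => -[]. Qed.

Lemma psum_X U W (phi : nat -> {linear U -> W}) a :
  psum phi (pX a) = psum (phi \o succn) a.
Proof.
have [n an] := pol_bounded a.
rewrite (psumE _ an) (@psumE _ _ _ _ n.+1); last by case=> // i; exact: an.
by rewrite big_ord_recl linear0 add0r.
Qed.

Definition pev U (s : {linear U -> U}) : pol U -> U :=
  psum (fun i => iter i s : {linear U -> U}).

Lemma pev_X U (s : {linear U -> U}) a : pev s (pX a) = s (pev s a).
Proof. by rewrite /pev psum_X {2}/psum linear_sum. Qed.

HB.instance Definition _ U (s : {linear U -> U}) :=
  GRing.Linear.copy (pev s) (psum (fun i => iter i s : {linear U -> U})).

Lemma pev_C U (s : {linear U -> U}) u : pev s (pC u) = u.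
Proof. exact: psum_C. Qed.

Lemma pev_polmap U V (s : {linear U -> U}) (s' : {linear V -> V}) (f : {linear U -> V}) :
  (forall u, f (s u) = s' (f u)) -> forall a, pev s' (polmap f a) = f (pev s a).
Proof.
move=> fs; elim/pol_ind' => [|u a IH]; first by rewrite !linear0.
by rewrite !linearD /= polmap_C polmap_X pev_X !pev_C IH pev_X fs.
Qed.

Lemma pev_iterX U (s : {linear U -> U}) n a :
  pev s (iter n (@pX U) a) = iter n s (pev s a).
Proof. by apply: iter_intertwine; exact: pev_X. Qed.

Lemma polmap_iterX U V (f : {linear U -> V}) n a :
  polmap f (iter n (@pX U) a) = iter n (@pX V) (polmap f a).
Proof. by apply: iter_intertwine; exact: polmap_X. Qed.

Definition pXs U (s : {linear U -> U}) (a : pol U) : pol U := pX a - polmap s a.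

Lemma pXs_linear U (s : {linear U -> U}) : linear (pXs s).
Proof. by move=> c a b; rewrite /pXs !linearP /= scalerDr addrACA. Qed.
HB.instance Definition _ U (s : {linear U -> U}) := GRing.isLinear.Build k
  (pol U) (pol U) *:%R (pXs s) (pXs_linear s).

(** If t a = s a, then a_i = s a_{i+1} for every i, so vanishing propagates downwards from the
    degree bound. *)
Lemma pXs_inj U (s : {linear U -> U}) a : pXs s a = 0 -> a = 0.
Proof.
move=> /eqP; rewrite subr_eq0 => /eqP Xs.
have [n an] := pol_bounded a.
suff am m i : (n <= i + m)%N -> pcoef a i = 0 by apply: polP => i; exact: am (leq_addl _ _).
elim: m i => [|m IH] i; first by rewrite addn0; exact: an.
rewrite addnS -addSn => /IH ai; have := congr1 (fun b => pcoef b i.+1) Xs.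
by rewrite /= ai linear0.
Qed.

Lemma pev_pXs U (s : {linear U -> U}) a : pev s (pXs s a) = 0.
Proof. by rewrite /pXs linearB /= pev_X (@pev_polmap _ _ s) // subrr. Qed.

(** Division with remainder by the monic t - s, the remainder being the value at s. Together with
    [pXs_inj] and [pev_pXs] this makes U[t] -> U[t] -> U a resolution of the k[t]-module on which t
    acts as s. *)
Lemma pXs_ker_pev U (s : {linear U -> U}) a : exists b, a = pC (pev s a) + pXs s b.
Proof.
elim/pol_ind': a => [|u a [b ab]].
  by exists 0; rewrite !linear0 addr0.
exists (pX b + pC (pev s a)).
have E : pX a = pX (pC (pev s a)) + pXs s (pX b).
  rewrite {1}ab linearD; congr (_ + _).
  by rewrite /pXs linearB /= polmap_X.
have -> : pev s (pC u + pX a) = u + s (pev s a).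
  by rewrite linearD /= pev_C pev_X.
have -> : pXs s (pX b + pC (pev s a)) =
    pXs s (pX b) + (pX (pC (pev s a)) - pC (s (pev s a))).
  by rewrite linearD /=; congr (_ + _); rewrite /pXs polmap_C.
rewrite E linearD /= -addrA; congr (_ + _).
move: (pXs s (pX b)) (pX (pC _)) (pC (s _)) => x y z; by rewrite [RHS]addrC -!addrA addNr addr0 addrC.
Qed.

(* The quotient of [t^n - s^n] by [t - s]. *)
Fixpoint pquo U (s : {linear U -> U}) (n : nat) (a : pol U) : pol U :=
  if n is m.+1 then iter m (@pX U) a + pquo s m (polmap s a) else 0.

Lemma pquo_linear U (s : {linear U -> U}) n : linear (pquo s n).
Proof.
elim: n => [|n IH] c a b /=; first by rewrite scaler0 addr0.
by rewrite !linearP /= IH scalerDr addrACA.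
Qed.
HB.instance Definition _ U (s : {linear U -> U}) n := GRing.isLinear.Build k
  (pol U) (pol U) *:%R (pquo s n) (@pquo_linear U s n).

Lemma pquo_X U (s : {linear U -> U}) n a : pquo s n (pX a) = pX (pquo s n a).
Proof.
elim: n a => [|n IH] a /=; first by rewrite linear0.
by rewrite polmap_X IH linearD -iterSr.
Qed.

Lemma pquo_polmap U V (s : {linear U -> U}) (s' : {linear V -> V}) (f : {linear U -> V}) n :
  (forall u, f (s u) = s' (f u)) ->
  forall a, polmap f (pquo s n a) = pquo s' n (polmap f a).
Proof.
move=> fs; elim: n => [|n IH] a /=; first by rewrite linear0.
rewrite linearD /= polmap_iterX IH; congr (_ + pquo _ _ _).
by apply: polP => i /=.
Qed.

Lemma pXs_polmap U V (s : {linear U -> U}) (s' : {linear V -> V}) (f : {linear U -> V}) :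
  (forall u, f (s u) = s' (f u)) ->
  forall a, polmap f (pXs s a) = pXs s' (polmap f a).
Proof.
move=> fs a; rewrite /pXs linearB /= polmap_X; congr (_ - _).
by apply: polP => i /=.
Qed.

Lemma pXs_pquo U (s : {linear U -> U}) n a :
  pXs s (pquo s n a) = iter n (@pX U) a - iter n (polmap s) a.
Proof.
elim: n a => [|n IH] a /=; first by rewrite linear0 subrr.
rewrite linearD /= IH /pXs polmap_iterX.
by rewrite -iterSr addrA addrNK.
Qed.

Lemma pquo_pXs U (s : {linear U -> U}) n a : pquo s n (pXs s a) = pXs s (pquo s n a).
Proof. by rewrite /pXs linearB /= pquo_X (@pquo_polmap _ _ s s). Qed.

Lemma iter_polmap U (s : {linear U -> U}) n a i :
  pcoef (iter n (polmap s) a) i = iter n s (pcoef a i).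
Proof. by elim: n => //= n ->. Qed.

(** Only the summand s^(n-1) of the quotient survives at t = 0. For n = p this produces the entry
    t^(p-1) of the matrix in the theorem. *)
Lemma pquo_coef0 U (s : {linear U -> U}) n a :
  (0 < n)%N -> pcoef (pquo s n a) 0 = iter n.-1 s (pcoef a 0).
Proof.
case: n => // n _; elim: n a => [|n IH] a; first by rewrite /= addr0.
by rewrite -[pquo _ _ _]/(iter n.+1 (@pX U) a + _) pcoefD IH /= add0r -iterSr.
Qed.

End ModulePolynomials.

(** * Induced modules are flat *)

Section InducedModule.
Variables (k : fieldType) (p : nat).
Implicit Types U V : lmodType k.

Definition ind_t U V (x : (pol U * pol V)%type) : (pol U * pol V)%type :=
  (pX x.1, pX x.2).

Definition ind_tau U V (x : (pol U * pol V)%type) : (pol V * pol U)%type :=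
  (iter p (@pX k V) x.2, x.1).

Lemma ind_t_linear U V : linear (@ind_t U V).
Proof. by move=> c x y; rewrite /ind_t /= !linearP. Qed.

Lemma ind_tau_linear U V : linear (@ind_tau U V).
Proof. by move=> c x y; rewrite /ind_tau /= !linearP. Qed.

Lemma iter_ind_t U V n (x : (pol U * pol V)%type) :
  iter n (@ind_t U V) x = (iter n (@pX k U) x.1, iter n (@pX k V) x.2).
Proof. by elim: n => [|n /= ->] //; case: x. Qed.

(* [A (x)_k U] for the graded vector space [U = (U0, U1)]: the pair [(a, b)]
   stands for [a + tau b]. *)
Definition induced U0 U1 : gmod k p.
Proof.
exists (pol U0 * pol U1)%type (pol U1 * pol U0)%type
  (mklin (@ind_t_linear U0 U1)) (mklin (@ind_t_linear U1 U0))
  (mklin (@ind_tau_linear U0 U1)) (mklin (@ind_tau_linear U1 U0)).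
- by move=> x; rewrite [RHS]iter_ind_t.
- by move=> x; rewrite [RHS]iter_ind_t.
- by move=> x; rewrite /= /ind_t /ind_tau /= -iterSr.
- by move=> x; rewrite /= /ind_t /ind_tau /= -iterSr.
Defined.

Section InducedFlat.
Variables (U0 U1 : lmodType k) (N1 N2 : gmod k p) (f : ghom N1 N2).
Variable r : {linear gtot N2 -> gtot N1}.
Hypothesis rK : cancel (ghtot f) r.
Let P := induced U0 U1.
Variables (W : lmodType k) (tp : gtot N1 -> gtot P -> W).
Hypothesis btp : balanced tp.

Lemma tp_linear n : linear (tp n).
Proof. by move=> c x y; rewrite (balDr btp) (balZr btp). Qed.

Definition ltp n : {linear gtot P -> W} := mklin (tp_linear n).

Section Extension.
Variables (U : lmodType k) (E : {linear pol U -> gtot P}).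
Hypothesis EX : forall a, E (pX a) = act_t (E a).

(** The retraction [r] is only k-linear, so the powers of t are moved onto [n] before [r] is
    applied: t^i u is paired through r(t^i n). This makes the pairing compatible with t on all of
    [N2]. *)
Definition ext (n : gtot N2) : pol U -> W :=
  psum (fun i => ltp (r (iter i (@act_t k p N2) n)) \o (E \o @pC k U)).

Lemma extP c n n' a : ext (c *: n + n') a = c *: ext n a + ext n' a.
Proof.
rewrite /ext /psum scaler_sumr -big_split; apply: eq_bigr => i _ /=.
by rewrite !linearP (balDl btp) (balZl btp).
Qed.

Lemma extPr n c a b : ext n (c *: a + b) = c *: ext n a + ext n b.
Proof. exact: linearP. Qed.

Lemma ext_t n a : ext (act_t n) a = ext n (pX a).
Proof.
by rewrite /ext psum_X; apply: eq_bigr => i _; rewrite /= -iterSr.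
Qed.

Lemma ext_iter m n a :
  ext (iter m (@act_t k p N2) n) a = ext n (iter m (@pX k U) a).
Proof. by elim: m a => //= m IH a; rewrite ext_t IH -iterSr. Qed.

Lemma ext_ghtot n a : ext (ghtot f n) a = tp n (E a).
Proof.
elim/pol_ind': a n => [|u a IH] n.
  by rewrite linear0 [RHS](linear0 (ltp n)) /ext linear0.
rewrite -[pC u]scale1r extPr -ext_t -ghtot_act_t IH (balt btp) -EX !linearP /=.
rewrite (balDr btp) (balZr btp) /ext psum_C /= rK.
by [].
Qed.

End Extension.

Definition emb0 (a : pol U0) : gtot P := ((a, 0), (0, 0)).
Definition emb1 (a : pol U1) : gtot P := ((0, 0), (a, 0)).

Lemma emb0_linear : linear emb0.
Proof.
by move=> c a b; rewrite /emb0; congr ((_, _), (_, _)); rewrite /= scaler0 addr0.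
Qed.

Lemma emb1_linear : linear emb1.
Proof.
by move=> c a b; rewrite /emb1; congr ((_, _), (_, _)); rewrite /= scaler0 addr0.
Qed.

Definition lemb0 : {linear pol U0 -> gtot P} := mklin emb0_linear.
Definition lemb1 : {linear pol U1 -> gtot P} := mklin emb1_linear.

Lemma emb0_X a : lemb0 (pX a) = act_t (lemb0 a).
Proof. by rewrite /act_t /= /ind_t /= !linear0. Qed.

Lemma emb1_X a : lemb1 (pX a) = act_t (lemb1 a).
Proof. by rewrite /act_t /= /ind_t /= !linear0. Qed.

Definition tpext (n : gtot N2) (x : gtot P) : W :=
  ext lemb0 n x.1.1 + ext lemb1 n x.2.1
  + (ext lemb1 (act_tau n) x.1.2 + ext lemb0 (act_tau n) x.2.2).

Lemma tpextP c n n' x : tpext (c *: n + n') x = c *: tpext n x + tpext n' x.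
Proof.
rewrite /tpext linearP /= !extP !scalerDr.
by rewrite [X in X + _ = _]addrACA [X in _ + X = _]addrACA [LHS]addrACA.
Qed.

Lemma tpextPr n c x y : tpext n (c *: x + y) = c *: tpext n x + tpext n y.
Proof.
by rewrite /tpext /= !extPr !scalerDr [X in X + _ = _]addrACA [X in _ + X = _]addrACA [LHS]addrACA.
Qed.

Lemma tpext_balanced : balanced tpext.
Proof.
split.
- by move=> n n' x; have := tpextP 1 n n' x; rewrite !scale1r.
- by move=> n x y; have := tpextPr n 1 x y; rewrite !scale1r.
- move=> c n x; have := tpextP c n 0 x; rewrite addr0 => ->.
  by have := tpextP (-1) 0 0 x; rewrite !scaleN1r oppr0 addr0 addNr => ->; rewrite addr0.
- move=> c n x; have := tpextPr n c x 0; rewrite addr0 => ->.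
  by have := tpextPr n (-1) 0 0; rewrite !scaleN1r oppr0 addr0 addNr => ->; rewrite addr0.
- by move=> n x; rewrite /tpext act_tau_t !ext_t.
- move=> n x; rewrite /tpext act_tau2 !ext_iter /= addrC; congr (_ + _).
    by rewrite addrC.
  by rewrite addrC.
Qed.

Lemma tpext_ghtot n x : tpext (ghtot f n) x = tp n x.
Proof.
rewrite /tpext -ghtot_act_tau !(ext_ghtot emb0_X) !(ext_ghtot emb1_X) !(baltau btp).
rewrite -!(balDr btp); congr (tp n _).
case: x => [[a b] [c d]]; rewrite /act_tau /= /ind_tau /= !linear0.
by congr ((_, _), (_, _)); rewrite /= ?addr0 ?add0r.
Qed.

End InducedFlat.

(** A balanced map out of [N1] and A (x)_k U is determined by its restriction to U. That restriction
    extends along [f] by a k-linear retraction and then, by balancedness, to a balanced map on [N2].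
    The map detecting tensors over [N1] thus factors through tensors over [N2]. *)
Lemma induced_flat U0 U1 : flat (induced U0 U1).
Proof.
move=> N1 N2 f injf s.
have [r rK] := @linear_retraction k (gtot N2) (gtot N1) (ghtot f) injf.
have [W [tp [btp tpP]]] := tensor_exists N1 (induced U0 U1).
move=> /(tens_zero_feval (tpext_balanced r btp)); rewrite /feval big_map /= => s0.
apply/tpP; rewrite -[RHS]s0; apply: eq_bigr => x _.
by rewrite (tpext_ghtot rK btp).
Qed.

End InducedModule.

(** * Flatness from a contraction *)

Section Contraction.
Variable k : fieldType.

Section Graded.
Variables U V : lmodType k.

Fixpoint gsum (A : V -> V) (G : U -> V) (s : U -> U) n x : V :=
  if n is m.+1 then G x + A (gsum A G s m (s x)) else 0.

Lemma gsum_linear (A : {linear V -> V}) (G : {linear U -> V})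
  (s : {linear U -> U}) n : linear (gsum A G s n).
Proof.
elim: n => [|n IH] c x y /=; first by rewrite scaler0 addr0.
by rewrite !linearP IH linearP scalerDr addrACA.
Qed.

Lemma gsum_intertwine (A : {linear V -> V}) G s n (t : U -> U) (t' : {linear V -> V}) :
  (forall x, A (t' x) = t' (A x)) -> (forall x, G (t x) = t' (G x)) ->
  (forall x, s (t x) = t (s x)) ->
  forall x, gsum A G s n (t x) = t' (gsum A G s n x).
Proof.
move=> At Gt st; elim: n => [|n IH] x /=; first by rewrite linear0.
by rewrite Gt st IH At linearD.
Qed.

End Graded.

(** [gsum] is the sum of A^j G s^j over j < n. As tau commutes with A and s, the homotopy
    telescopes: A^j (1 - A s) s^j summed gives 1 - A^n s^n. The powers of A stay on the left, so A
    and s need not commute. *)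
Lemma gsum_homotopy (U V : lmodType k) (A : {linear V -> V}) (A' : {linear U -> U})
    (s : U -> U) (s' : V -> V) (G : U -> V) (G' : V -> U)
    (tau : U -> V) (tau' : {linear V -> U}) n :
  (forall y, tau' (A y) = A' (tau' y)) -> (forall x, tau (s x) = s' (tau x)) ->
  (forall x, tau' (G x) + G' (tau x) = x - A' (s x)) ->
  forall x, tau' (gsum A G s n x) + gsum A' G' s' n (tau x) =
    x - iter n A' (iter n s x).
Proof.
move=> tA ts tG; elim: n => [|n IH] x; first by rewrite /= linear0 addr0 subrr.
rewrite linearD /= addrACA tG tA -ts -linearD IH linearB /= -iterSr.
by rewrite addrA addrNK.
Qed.

Variable p : nat.

(** Write g for the homotopy [gsum] from 1 to A^n s^n. The map [sg n] is x |-> g(tau x) + tau (x)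
    g(x); it is A-linear since tau^2 = t^p commutes with g. The multiplication map [mu] brings it to
    tau g + g tau = 1 - A^n s^n, which fixes x once s^n x = 0. The maps [c0], [c1], [d0], [d1] let
    an induced module from vector spaces replace A (x)_k[t] K. *)
Lemma flat_contractible (K : gmod k p) (U0 U1 : lmodType k)
    (c0 : {linear gm0 K -> pol U0}) (c1 : {linear gm1 K -> pol U1})
    (d0 : {linear pol U0 -> gm0 K}) (d1 : {linear pol U1 -> gm1 K})
    (A s : ghom K K)
    (G0 : {linear gm0 K -> gm1 K}) (G1 : {linear gm1 K -> gm0 K}) :
  cancel c0 d0 -> cancel c1 d1 ->
  (forall x, c0 (gt0 K x) = pX (c0 x)) -> (forall x, c1 (gt1 K x) = pX (c1 x)) ->
  (forall a, d0 (pX a) = gt0 K (d0 a)) -> (forall a, d1 (pX a) = gt1 K (d1 a)) ->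
  (forall x, G0 (gt0 K x) = gt1 K (G0 x)) -> (forall x, G1 (gt1 K x) = gt0 K (G1 x)) ->
  (forall x, gtau10 K (G0 x) + G1 (gtau01 K x) = x - gh0 A (gh0 s x)) ->
  (forall x, gtau01 K (G1 x) + G0 (gtau10 K x) = x - gh1 A (gh1 s x)) ->
  (forall x, exists n, iter n (gh0 s) x = 0) ->
  (forall x, exists n, iter n (gh1 s) x = 0) ->
  flat K.
Proof.
move=> cd0 cd1 c0X c1X d0X d1X G0t G1t h0 h1 nil0 nil1.
pose P := induced p U0 U1.
have [g0 g0E] : exists g0 : nat -> {linear gm0 K -> gm1 K},
    forall n x, g0 n x = gsum (gh1 A) G0 (gh0 s) n x.
  by exists (fun n => mklin (gsum_linear (gh1 A) G0 (gh0 s) n)).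
have [g1 g1E] : exists g1 : nat -> {linear gm1 K -> gm0 K},
    forall n x, g1 n x = gsum (gh0 A) G1 (gh1 s) n x.
  by exists (fun n => mklin (gsum_linear (gh0 A) G1 (gh1 s) n)).
have g0t n x : g0 n (gt0 K x) = gt1 K (g0 n x).
  by rewrite !(g0E, g1E); apply: gsum_intertwine => // y; rewrite ?ghom_t1 ?ghom_t0.
have g1t n x : g1 n (gt1 K x) = gt0 K (g1 n x).
  by rewrite !(g0E, g1E); apply: gsum_intertwine => // y; rewrite ?ghom_t1 ?ghom_t0.
have s0l n : linear (fun x => (c0 (g1 n (gtau01 K x)), c1 (g0 n x)) : gm0 P).
  by move=> c x y; rewrite !linearP.
have s1l n : linear (fun x => (c1 (g0 n (gtau10 K x)), c0 (g1 n x)) : gm1 P).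
  by move=> c x y; rewrite !linearP.
have sig n : exists sg : ghom K P, forall x, ghtot sg x =
    ((c0 (g1 n (gtau01 K x.1)), c1 (g0 n x.1)),
     (c1 (g0 n (gtau10 K x.2)), c0 (g1 n x.2))).
  unshelve eexists.
    exists (mklin (s0l n)) (mklin (s1l n)) => x.
    - by rewrite /= /ind_t /= gcomm_0 g1t c0X g0t c1X.
    - by rewrite /= /ind_t /= gcomm_1 g0t c1X g1t c0X.
    - rewrite /= /ind_tau /= gtau2_0; congr (_, _).
      rewrite (iter_intertwine _ (g0t n)); exact: iter_intertwine.
    - rewrite /= /ind_tau /= gtau2_1; congr (_, _).
      rewrite (iter_intertwine _ (g1t n)); exact: iter_intertwine.
  by [].
have [sg sgE] := choice sig.
have m0l : linear (fun x : gm0 P => d0 x.1 + gtau10 K (d1 x.2)).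
  by move=> c x y; rewrite !linearP scalerDr addrACA.
have m1l : linear (fun x : gm1 P => d1 x.1 + gtau01 K (d0 x.2)).
  by move=> c x y; rewrite !linearP scalerDr addrACA.
have [mu muE] : exists mu : ghom P K, forall x, ghtot mu x =
    (d0 x.1.1 + gtau10 K (d1 x.1.2), d1 x.2.1 + gtau01 K (d0 x.2.2)).
  unshelve eexists.
    exists (mklin m0l) (mklin m1l) => x.
    - by rewrite /= d0X d1X gcomm_1 linearD.
    - by rewrite /= d0X d1X gcomm_0 linearD.
    - by rewrite /= (iter_intertwine _ d1X) linearD gtau2_1 addrC.
    - by rewrite /= (iter_intertwine _ d0X) linearD gtau2_0 addrC.
  by [].
apply: (flat_local_retract (mu := mu) (sigma := sg)); first exact: induced_flat.
move=> [x y]; have [n0 n0P] := nil0 x; have [n1 n1P] := nil1 y.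
exists (maxn n0 n1) => n; rewrite geq_max => /andP[ln0 ln1].
rewrite sgE muE /= !cd0 !cd1; congr (_, _).
  rewrite addrC g0E g1E [LHS](gsum_homotopy n (s' := gh1 s) _ _ h0).
  - by rewrite (iter_eq0_le n0P) // linear0 subr0.
  - by move=> z; rewrite ghom_tau10.
  - by move=> z; rewrite ghom_tau01.
rewrite addrC g0E g1E [LHS](gsum_homotopy n (s' := gh0 s) _ _ h1).
- by rewrite (iter_eq0_le n1P) // linear0 subr0.
- by move=> z; rewrite ghom_tau01.
- by move=> z; rewrite ghom_tau10.
Qed.

End Contraction.

(** * The first syzygy *)

Section Resolution.
Variables (k : fieldType) (p : nat).
Hypothesis p_gt0 : (0 < p)%N.

(** Constructions are carried out for even elements only; applying them to the shifted module gives
    the odd half. *)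
Definition parity_shift (M : gmod k p) : gmod k p :=
  GMod (@gtau2_1 k p M) (@gtau2_0 k p M) (@gcomm_1 k p M) (@gcomm_0 k p M).

Local Notation op := parity_shift.

Section Split.
Variables U V : lmodType k.

Lemma inl_linear : linear (fun u : U => (u, 0 : V)).
Proof. by move=> c x y; congr (_, _); rewrite /= scaler0 addr0. Qed.
Lemma inr_linear : linear (fun v : V => (0 : U, v)).
Proof. by move=> c x y; congr (_, _); rewrite /= scaler0 addr0. Qed.
Lemma fst_linear : linear (fun x : (U * V)%type => x.1).
Proof. by []. Qed.
Lemma snd_linear : linear (fun x : (U * V)%type => x.2).
Proof. by []. Qed.

Definition pjoin (x : (pol U * pol V)%type) : pol (U * V)%type :=
  polmap (mklin inl_linear) x.1 + polmap (mklin inr_linear) x.2.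
Definition psplit (a : pol (U * V)%type) : (pol U * pol V)%type :=
  (polmap (mklin fst_linear) a, polmap (mklin snd_linear) a).

Lemma pjoin_linear : linear pjoin.
Proof. by move=> c x y; rewrite /pjoin /= !linearP scalerDr addrACA. Qed.
Lemma psplit_linear : linear psplit.
Proof. by move=> c x y; rewrite /psplit /= !linearP. Qed.

HB.instance Definition _ := GRing.isLinear.Build k (pol U * pol V)%type
  (pol (U * V)%type) *:%R pjoin pjoin_linear.
HB.instance Definition _ := GRing.isLinear.Build k (pol (U * V)%type)
  (pol U * pol V)%type *:%R psplit psplit_linear.

Lemma pjoinK : cancel pjoin psplit.
Proof.
move=> [x y]; congr (_, _); apply: polP => i.
  by rewrite -[LHS]/(pcoef x i + 0) addr0.
by rewrite -[LHS]/(0 + pcoef y i) add0r.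
Qed.

Lemma pjoin_t x : pjoin (ind_t x) = pX (pjoin x).
Proof. by rewrite /pjoin /= !polmap_X linearD. Qed.

Lemma psplit_t a : psplit (pX a) = ind_t (psplit a).
Proof. by rewrite /psplit !polmap_X. Qed.

Definition coef0 (x : (pol U * pol V)%type) : (U * V)%type :=
  (pcoef x.1 0, pcoef x.2 0).

Lemma coef0_linear : linear coef0.
Proof. by []. Qed.

HB.instance Definition _ := GRing.isLinear.Build k (pol U * pol V)%type
  (U * V)%type *:%R coef0 coef0_linear.

HB.instance Definition _ := GRing.isLinear.Build k (pol U * pol V)%type
  (pol U * pol V)%type *:%R (@ind_t k U V) (@ind_t_linear k U V).

Lemma ind_t_inj : injective (@ind_t k U V).
Proof.
by move=> [a b] [c d] E; congr (_, _); apply: pX_inj;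
  [exact: (congr1 fst E)|exact: (congr1 snd E)].
Qed.

Definition down2 (x : (pol U * pol V)%type) : (pol U * pol V)%type :=
  (pdown x.1, pdown x.2).

Lemma ind_t_down2 x : coef0 x = 0 -> ind_t (down2 x) = x.
Proof.
case: x => a b E; rewrite /ind_t /down2 /=.
by rewrite !pX_pdown //; [exact: (congr1 snd E)|exact: (congr1 fst E)].
Qed.

Lemma down2_linear : linear down2.
Proof. by move=> c x y; rewrite /down2 /= !linearP. Qed.

HB.instance Definition _ := GRing.isLinear.Build k (pol U * pol V)%type
  (pol U * pol V)%type *:%R down2 down2_linear.

Definition polmap2 (s : {linear U -> U}) (s' : {linear V -> V})
  (x : (pol U * pol V)%type) : (pol U * pol V)%type := (polmap s x.1, polmap s' x.2).

Lemma polmap2_linear s s' : linear (polmap2 s s').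
Proof. by move=> c x y; rewrite /polmap2 /= !linearP. Qed.

HB.instance Definition _ s s' := GRing.isLinear.Build k (pol U * pol V)%type
  (pol U * pol V)%type *:%R (polmap2 s s') (polmap2_linear s s').

(** On the syzygy this sends (t - t_M) x + (tau - tau_M) y to (t - t_M) y. It is the k[t]-linear
    homotopy between multiplication by t and the action of t_M. *)
Definition swap0 (x : (pol U * pol V)%type) : (pol V * pol U)%type := (x.2, 0).

Lemma swap0_linear : linear swap0.
Proof. by move=> c x y; congr (_, _); rewrite /= scaler0 addr0. Qed.

HB.instance Definition _ := GRing.isLinear.Build k (pol U * pol V)%type
  (pol V * pol U)%type *:%R swap0 swap0_linear.

End Split.

Section Lift.
Variables U V : lmodType k.

Definition plift (h : {linear (U * V)%type -> (V * U)%type})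
    (x : (pol U * pol V)%type) : (pol V * pol U)%type :=
  psplit (polmap h (pjoin x)).

Lemma plift_linear h : linear (plift h).
Proof. by move=> c x y; rewrite /plift !linearP. Qed.

HB.instance Definition _ h := GRing.isLinear.Build k (pol U * pol V)%type
  (pol V * pol U)%type *:%R (plift h) (plift_linear h).

Lemma plift_t h x : plift h (ind_t x) = ind_t (plift h x).
Proof. by rewrite /plift pjoin_t polmap_X psplit_t. Qed.

Lemma coef0_plift h x : coef0 (plift h x) = h (coef0 x).
Proof.
have -> : coef0 x = pcoef (pjoin x) 0.
  case: x => a b; rewrite -[RHS]/(pcoef a 0 + 0, 0 + pcoef b 0).
  by rewrite addr0 add0r.
by rewrite /coef0 /=; case: (h _).
Qed.

End Lift.

Section Syzygy.
Variable M : gmod k p.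

(* The action of [tau] on the first syzygy of [M]: the pair [(x, y)] stands
   for the element [(t - t_M) x + (tau - tau_M) y] of [A (x)_k M]. *)
Definition syz_tau (x : (pol (gm0 M) * pol (gm1 M))%type)
    : (pol (gm1 M) * pol (gm0 M))%type :=
  (polmap (gtau01 M) x.1 + pquo (gt1 M) p x.2,
   pXs (gt0 M) x.1 - polmap (gtau10 M) x.2).

Lemma syz_tau_linear : linear syz_tau.
Proof.
move=> c x y; rewrite /syz_tau /= !linearP /= scalerDr.
by congr (_, _); rewrite /= ?scalerDr addrACA.
Qed.

HB.instance Definition _ := GRing.isLinear.Build k
  (pol (gm0 M) * pol (gm1 M))%type (pol (gm1 M) * pol (gm0 M))%type
  *:%R syz_tau syz_tau_linear.

Lemma syz_tau_t x : syz_tau (ind_t x) = ind_t (syz_tau x).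
Proof.
rewrite /syz_tau /ind_t /= !polmap_X pquo_X linearD /= linearB /=; congr (_, _ - _).
by rewrite /pXs polmap_X linearB.
Qed.

Lemma syz_tau_polmap2 x :
  syz_tau (polmap2 (gt0 M) (gt1 M) x) = polmap2 (gt1 M) (gt0 M) (syz_tau x).
Proof.
rewrite /syz_tau /polmap2 /= linearD linearB /=.
rewrite (@pquo_polmap _ _ _ (gt1 M) (gt1 M)) //.
rewrite (@pXs_polmap _ _ _ (gt0 M) (gt0 M)) //.
by congr (_ + _, _ - _); apply: polP => i; rewrite /= ?gcomm_0 ?gcomm_1.
Qed.

End Syzygy.

(** Let q be the quotient of t^p - t_M^p by t - t_M. The matrix with rows (tau_M, q) and (t - t_M, -
    tau_M) has square tau_M^2 + q (t - t_M) = t^p, because tau_M^2 = t_M^p. Its columns come from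
    rewriting tau (t - t_M) x and tau (tau - tau_M) y in terms of the same two kinds of elements. *)
Lemma syz_tau2 M (x : (pol (gm0 M) * pol (gm1 M))%type) :
  syz_tau (M := op M) (syz_tau x) = iter p (@ind_t k (gm0 M) (gm1 M)) x.
Proof.
rewrite iter_ind_t /syz_tau /=; congr (_, _).
  rewrite linearD linearB /= (pquo_polmap _ (@gcomm_1 _ _ M)).
  rewrite addrACA subrr addr0 pquo_pXs pXs_pquo.
  have -> : polmap (gtau10 M) (polmap (gtau01 M) x.1) = iter p (polmap (gt0 M)) x.1.
    by apply: polP => i; rewrite iter_polmap /= gtau2_0.
  by rewrite addrC addrNK.
rewrite linearD linearB /= pXs_pquo.
have -> : polmap (gtau01 M) (polmap (gtau10 M) x.2) = iter p (polmap (gt1 M)) x.2.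
  by apply: polP => i; rewrite iter_polmap /= gtau2_1.
rewrite (pXs_polmap (@gcomm_0 _ _ M)).
by rewrite opprB addrC -addrA addKr addrC addrNK.
Qed.

Definition syz (M : gmod k p) : gmod k p.
Proof.
exists (pol (gm0 M) * pol (gm1 M))%type (pol (gm1 M) * pol (gm0 M))%type
  (@ind_t k (gm0 M) (gm1 M)) (@ind_t k (gm1 M) (gm0 M))
  (mklin (@syz_tau_linear M)) (mklin (@syz_tau_linear (op M))).
- exact: syz_tau2.
- exact: (@syz_tau2 (op M)).
- exact: syz_tau_t.
- exact: (@syz_tau_t (op M)).
Defined.

Definition mf0 (M : gmod k p) (x : (gm0 M * gm1 M)%type) : (gm1 M * gm0 M)%type :=
  (gtau01 M x.1 + iter p.-1 (gt1 M) x.2, - gt0 M x.1 - gtau10 M x.2).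

Lemma mf0_linear M : linear (@mf0 M).
Proof.
move=> c x y; rewrite /mf0 /= !linearP /=.
by congr (_, _); rewrite /= scalerDr addrACA.
Qed.

HB.instance Definition _ M := GRing.isLinear.Build k
  (gm0 M * gm1 M)%type (gm1 M * gm0 M)%type *:%R (@mf0 M) (@mf0_linear M).

Lemma coef0_syz_tau M x : coef0 (@syz_tau M x) = mf0 (coef0 x).
Proof.
congr (_, _).
  rewrite -[LHS]/(gtau01 M (pcoef x.1 0) + pcoef (pquo (gt1 M) p x.2) 0).
  by rewrite pquo_coef0.
rewrite -[LHS]/((0 - gt0 M (pcoef x.1 0)) - gtau10 M (pcoef x.2 0)).
by rewrite add0r.
Qed.

(* Up to sign, [mf0] is the restriction of [mf] to one parity, with the two
   summands exchanged. *)
Lemma mf0_exact M : max_image (@mf k p M) -> forall x : (gm0 M * gm1 M)%type,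
  mf0 x = 0 -> exists w : (gm1 M * gm0 M)%type, mf0 (M := op M) w = x.
Proof.
move=> mM [h g] E.
have E1 : gtau01 M h + iter p.-1 (gt1 M) g = 0 := congr1 fst E.
have E2 : - gt0 M h - gtau10 M g = 0 := congr1 snd E.
have [|[[w1 w1'] [w2 w2']]] := (mM ((0, g), (h, 0))).1.
  rewrite /mf /act_tau /act_t iter_act_t /= !linear0 /=.
  congr ((_, _), (_, _)) => /=; rewrite ?addr0 ?oppr0 ?subr0 ?add0r //.
  - by apply/eqP; rewrite -oppr_eq0 opprD addrC E2.
  - by rewrite -opprD addrC E1 oppr0.
move=> F; exists (- w2', - w1).
have F1 : gtau01 M w1 + gt1 M w2' = g := congr1 (fun z => z.1.2) F.
have F2 : - (iter p.-1 (@act_t k p M) (w1, w1')).1 - gtau10 M w2' = h :=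
  congr1 (fun z => z.2.1) F.
rewrite iter_act_t /= in F2.
rewrite /mf0 /= !linearN /= !opprK; congr (_, _); first by rewrite -F2 addrC.
by rewrite -F1 addrC.
Qed.

Lemma pcoef_iterX0 (U : lmodType k) n (a : pol U) :
  (0 < n)%N -> pcoef (iter n (@pX k U) a) 0 = 0.
Proof. by case: n. Qed.

(** This is the constant term of the identity [syz_tau2], since t^p has none for positive [p]. *)
Lemma mf0_mf0 M (x : (gm0 M * gm1 M)%type) : mf0 (M := op M) (mf0 x) = 0.
Proof.
have /(_ (pC x.1, pC x.2)) := @syz_tau2 M => /(congr1 (@coef0 _ _)).
rewrite (coef0_syz_tau (M := op M)) coef0_syz_tau.
rewrite iter_ind_t /coef0 !pcoef_iterX0 //= => <-.
Qed.

Definition swap4 (M : gmod k p) (z : gtot M * gtot M) : gtot (op M) * gtot (op M) :=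
  ((z.1.2, z.1.1), (z.2.2, z.2.1)).

Lemma mf_swap4 M (z : gtot M * gtot M) : mf (swap4 z) = swap4 (mf z).
Proof. by rewrite /mf /swap4 !iter_act_t. Qed.

Lemma max_image_op M : max_image (@mf k p M) -> max_image (@mf k p (op M)).
Proof.
move=> mM z; split=> [z0|[w <-]]; last exact: mf_mf.
have [|w wE] := (mM (swap4 (M := op M) z)).1.
  by apply: (etrans (mf_swap4 (M := op M) z)); rewrite z0.
exists (swap4 w); rewrite mf_swap4 wE.
by case: z {z0 wE} => [[? ?] [? ?]].
Qed.

(* With [r], [r'] von Neumann inverses of the two halves [f], [f'] of the
   differential, [r' (1 - r f)] is a contracting homotopy. *)
Lemma contraction_half (U V : lmodType k) (f : {linear U -> V}) (f' : {linear V -> U})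
    (r : {linear V -> U}) (r' : {linear U -> V}) :
  (forall u, f (r (f u)) = f u) -> (forall v, f' (r' (f' v)) = f' v) ->
  (forall u, f u = 0 -> exists v, f' v = u) -> (forall v, f (f' v) = 0) ->
  (forall u, f' (f u) = 0) ->
  forall u, f' (r' (u - r (f u))) + r (f u - r' (f' (f u))) = u.
Proof.
move=> fr fr' ex ff' f'f u; rewrite f'f linear0 subr0.
have [|v E] := ex (u - r (f u)); first by rewrite linearB /= fr subrr.
by rewrite -E fr' E addrNK.
Qed.

Lemma contraction_exists M : max_image (@mf k p M) ->
  exists (h0 : {linear (gm0 M * gm1 M)%type -> (gm1 M * gm0 M)%type})
    (h1 : {linear (gm1 M * gm0 M)%type -> (gm0 M * gm1 M)%type}),
  (forall x, mf0 (M := op M) (h0 x) + h1 (mf0 x) = x) /\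
  (forall y, mf0 (h1 y) + h0 (mf0 (M := op M) y) = y).
Proof.
move=> mM.
have ex0 := mf0_exact mM.
have ex1 : forall y : (gm1 M * gm0 M)%type, mf0 (M := op M) y = 0 ->
  exists w : (gm0 M * gm1 M)%type, mf0 (M := M) w = y := mf0_exact (max_image_op mM).
pose f : {linear (gm0 M * gm1 M)%type -> (gm1 M * gm0 M)%type} := mklin (@mf0_linear M).
pose f' : {linear (gm1 M * gm0 M)%type -> (gm0 M * gm1 M)%type} :=
  mklin (@mf0_linear (op M)).
have [r rP] := linear_regular_inverse f.
have [r' rP'] := linear_regular_inverse f'.
have l0 : linear (fun u => r' (u - r (f u))).
  by move=> c x y; rewrite -linearP; congr (r' _); rewrite !linearP /= scalerDr addrACA.
have l1 : linear (fun u => r (u - r' (f' u))).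
  by move=> c x y; rewrite -linearP; congr (r _); rewrite !linearP /= scalerDr addrACA.
exists (mklin l0), (mklin l1); split=> [u|v].
  exact: (contraction_half rP rP' ex0 (@mf0_mf0 (op M)) (@mf0_mf0 M)).
exact: (contraction_half rP' rP ex1 (@mf0_mf0 M) (@mf0_mf0 (op M))).
Qed.

End Resolution.

(** * Lifting a contraction modulo t to the polynomial modules *)

Section Defect.
Variables (k : fieldType) (U V : lmodType k).
Local Notation X := (pol U * pol V)%type.
Local Notation X' := (pol V * pol U)%type.
Variables (T : {linear X -> X'}) (T' : {linear X' -> X}).
Variables (h : {linear X -> X'}) (h' : {linear X' -> X}).

(* A homotopy that contracts modulo [t] contracts up to [t] times this map. *)
Definition defect (x : X) : X := down2 (x - (T' (h x) + h' (T x))).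

Hypothesis hP : forall x, coef0 (T' (h x) + h' (T x)) = coef0 x.

Lemma defectE x : ind_t (defect x) = x - (T' (h x) + h' (T x)).
Proof. by apply: ind_t_down2; rewrite linearB /= hP subrr. Qed.

Lemma defect_linear : linear defect.
Proof.
move=> c x y; rewrite /defect -[RHS]linearP; congr (down2 _).
have -> : T' (h (c *: x + y)) + h' (T (c *: x + y)) =
    c *: (T' (h x) + h' (T x)) + (T' (h y) + h' (T y)).
  by rewrite !linearP scalerDr addrACA.
by rewrite scalerBr opprD addrACA.
Qed.

Hypothesis Tt : forall x, T (ind_t x) = ind_t (T x).
Hypothesis Tt' : forall x, T' (ind_t x) = ind_t (T' x).
Hypothesis ht : forall x, h (ind_t x) = ind_t (h x).
Hypothesis ht' : forall x, h' (ind_t x) = ind_t (h' x).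

Lemma defect_t x : defect (ind_t x) = ind_t (defect x).
Proof.
apply: ind_t_inj; rewrite !defectE ht Tt' Tt ht' linearB /=.
by rewrite (linearD (@ind_t k U V)).
Qed.

End Defect.

(** As t is injective, it suffices to compare after multiplying by t. Both sides then reduce to T
    (T' h + h' T) = (T h' + h T') T, which holds because T T' and T' T are multiplication by t^p and
    [h] is k[t]-linear. *)
Lemma defect_tau (k : fieldType) (p : nat) (U V : lmodType k)
    (T : {linear (pol U * pol V)%type -> (pol V * pol U)%type})
    (T' : {linear (pol V * pol U)%type -> (pol U * pol V)%type})
    (h : {linear (pol U * pol V)%type -> (pol V * pol U)%type})
    (h' : {linear (pol V * pol U)%type -> (pol U * pol V)%type}) :
  (forall x, coef0 (T' (h x) + h' (T x)) = coef0 x) ->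
  (forall x, coef0 (T (h' x) + h (T' x)) = coef0 x) ->
  (forall x, T (ind_t x) = ind_t (T x)) -> (forall x, h (ind_t x) = ind_t (h x)) ->
  (forall x, T' (T x) = iter p (@ind_t k U V) x) ->
  (forall x, T (T' x) = iter p (@ind_t k V U) x) ->
  forall x, T (defect T T' h h' x) = defect T' T h' h (T x).
Proof.
move=> hP hP' Tt ht TT TT' x.
apply: ind_t_inj; rewrite -Tt !defectE // linearB linearD /=; congr (_ - _).
rewrite TT' TT addrC; congr (_ + _).
by apply/esym; apply: iter_intertwine; exact: ht.
Qed.

(** * Flatness of the first syzygy *)

Section SyzygyFlat.
Variables (k : fieldType) (p : nat).
Hypothesis p_gt0 : (0 < p)%N.
Variable M : gmod k p.
Hypothesis hnil : forall x : gtot M, exists n, iter n (@act_t k p M) x = 0.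

Lemma polmap_nil (U : lmodType k) (s : {linear U -> U}) :
  (forall u, exists n, iter n s u = 0) ->
  forall a, exists n, iter n (polmap s) a = 0.
Proof.
move=> nil; elim/pol_ind' => [|u a [n an]]; first by exists 0%N.
have [m um] := nil u; exists (maxn m n).
rewrite linearD /= (@iter_eq0_le _ _ _ m) ?leq_maxl //; last first.
  by rewrite -(iter_intertwine _ (fun v => esym (polmap_C s v))) um linear0.
rewrite -(iter_intertwine _ (fun b => esym (polmap_X s b))).
by rewrite (iter_eq0_le an) ?leq_maxr // linear0 addr0.
Qed.

Lemma polmap2_nil (U V : lmodType k) (s : {linear U -> U}) (s' : {linear V -> V}) :
  (forall u, exists n, iter n s u = 0) -> (forall u, exists n, iter n s' u = 0) ->
  forall x, exists n, iter n (polmap2 s s') x = 0.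
Proof.
move=> nil nil' [a b]; have [n an] := polmap_nil nil a; have [m bm] := polmap_nil nil' b.
exists (n + m)%N.
have -> : iter (n + m) (polmap2 s s') (a, b) =
    (iter (n + m) (polmap s) a, iter (n + m) (polmap s') b).
  by elim: (n + m)%N => //= l ->.
by rewrite [X in (_, X)]iterD bm linear0 addnC iterD an linear0.
Qed.

Lemma gt0_nil u : exists n, iter n (gt0 M) u = 0.
Proof. by have [n] := hnil (u, 0); rewrite iter_act_t => -[]; exists n. Qed.

Lemma gt1_nil u : exists n, iter n (gt1 M) u = 0.
Proof. by have [n] := hnil (0, u); rewrite iter_act_t => -[]; exists n. Qed.

Lemma swap0_homotopy (N : gmod k p) x :
  syz_tau (M := parity_shift N) (swap0 x) + swap0 (syz_tau (M := N) x) =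
  ind_t x - polmap2 (gt0 N) (gt1 N) x.
Proof.
rewrite /syz_tau /swap0 /= !linear0 !addr0.
congr (_, _); last by rewrite /= addr0.
by rewrite /= addrC addrNK.
Qed.

Lemma syz_flat : max_image (@mf k p M) -> flat (syz M).
Proof.
move=> mM; have [e0 [e1 [e0P e1P]]] := contraction_exists p_gt0 mM.
pose T : {linear (pol (gm0 M) * pol (gm1 M))%type -> (pol (gm1 M) * pol (gm0 M))%type}
  := mklin (@syz_tau_linear k p M).
pose T' : {linear (pol (gm1 M) * pol (gm0 M))%type -> (pol (gm0 M) * pol (gm1 M))%type}
  := mklin (@syz_tau_linear k p (parity_shift M)).
pose h : {linear (pol (gm0 M) * pol (gm1 M))%type -> (pol (gm1 M) * pol (gm0 M))%type}
  := mklin (plift_linear e0).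
pose h' : {linear (pol (gm1 M) * pol (gm0 M))%type -> (pol (gm0 M) * pol (gm1 M))%type}
  := mklin (plift_linear e1).
have hP x : coef0 (T' (h x) + h' (T x)) = coef0 x.
  rewrite linearD /= (coef0_syz_tau p_gt0 (M := parity_shift M)).
  by rewrite !coef0_plift (coef0_syz_tau p_gt0) e0P.
have hP' x : coef0 (T (h' x) + h (T' x)) = coef0 x.
  rewrite linearD /= coef0_plift !(coef0_syz_tau p_gt0).
  by rewrite (coef0_syz_tau p_gt0 (M := parity_shift M)) coef0_plift e1P.
have Tt x : T (ind_t x) = ind_t (T x) := syz_tau_t x.
have Tt' x : T' (ind_t x) = ind_t (T' x) := syz_tau_t (M := parity_shift M) x.
have ht x : h (ind_t x) = ind_t (h x) := plift_t e0 x.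
have ht' x : h' (ind_t x) = ind_t (h' x) := plift_t e1 x.
have TT x : T' (T x) = iter p (@ind_t k _ _) x := syz_tau2 x.
have TT' x : T (T' x) = iter p (@ind_t k _ _) x := syz_tau2 (M := parity_shift M) x.
have [A [A0 A1]] : exists A : ghom (syz M) (syz M),
    (forall x, gh0 A x = defect T T' h h' x) /\
    (forall x, gh1 A x = defect T' T h' h x).
  unshelve eexists.
    exists (mklin (defect_linear T T' h h')) (mklin (defect_linear T' T h' h)) => x.
    - exact: defect_t.
    - exact: defect_t.
    - by apply/esym; apply: defect_tau.
    - by apply/esym; apply: defect_tau.
  by [].
have [s [s0 s1]] : exists s : ghom (syz M) (syz M),
    (forall x, gh0 s x = polmap2 (gt0 M) (gt1 M) x) /\
    (forall x, gh1 s x = polmap2 (gt1 M) (gt0 M) x).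
  unshelve eexists.
    exists (mklin (polmap2_linear (gt0 M) (gt1 M)))
      (mklin (polmap2_linear (gt1 M) (gt0 M))) => x.
    - by rewrite /= /polmap2 /ind_t /= !polmap_X.
    - by rewrite /= /polmap2 /ind_t /= !polmap_X.
    - by apply/esym; exact: syz_tau_polmap2.
    - by apply/esym; exact: (syz_tau_polmap2 (M := parity_shift M)).
  by [].
(* The homotopy G = h + D swap0, with D the defect (here [A]), gives (T h + h T) + D (T swap0 +
   swap0 T) = (1 - t D) + D (t - t_M) = 1 - D t_M. The error has lost its factor t and gained the
   locally nilpotent [s], which is t_M on coefficients. *)
have l0 : linear (fun x => h x + gh1 A (swap0 x)).
  by move=> c x y; rewrite !linearP scalerDr addrACA.
have l1 : linear (fun x => h' x + gh0 A (swap0 x)).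
  by move=> c x y; rewrite !linearP scalerDr addrACA.
have swap0_t (U V : lmodType k) (x : (pol U * pol V)%type) :
    swap0 (ind_t x) = ind_t (swap0 x).
  by rewrite /swap0 /ind_t /= linear0.
apply: (flat_contractible (K := syz M) (c0 := @pjoin k (gm0 M) (gm1 M))
  (c1 := @pjoin k (gm1 M) (gm0 M)) (d0 := @psplit k (gm0 M) (gm1 M))
  (d1 := @psplit k (gm1 M) (gm0 M)) (A := A) (s := s)
  (G0 := mklin l0) (G1 := mklin l1)).
- exact: pjoinK.
- exact: pjoinK.
- exact: pjoin_t.
- exact: pjoin_t.
- exact: psplit_t.
- exact: psplit_t.
- by move=> x; rewrite -[gt0 _ _]/(ind_t x) -[gt1 _ _]/(ind_t _) /= ht swap0_t
    (ghom_t1 A) linearD.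
- by move=> x; rewrite -[gt1 _ _]/(ind_t x) -[gt0 _ _]/(ind_t _) /= ht' swap0_t
    (ghom_t0 A) linearD.
- move=> x; rewrite -[gtau10 _]/T' -[gtau01 _]/T.
  transitivity ((T' (h x) + h' (T x)) + gh0 A (T' (swap0 x) + swap0 (T x))).
    rewrite -[LHS]/(T' (h x + gh1 A (swap0 x)) + (h' (T x) + gh0 A (swap0 (T x)))).
    rewrite (linearD T') (linearD (gh0 A)) addrACA; congr (_ + (_ + _)).
    exact: (esym (ghom_tau10 A (swap0 x))).
  rewrite [X in gh0 A X](swap0_homotopy x) linearB /= s0 addrA; congr (_ - _).
  by rewrite A0 defect_t // defectE // addrC addrNK.
- move=> x; rewrite -[gtau10 _]/T' -[gtau01 _]/T.
  transitivity ((T (h' x) + h (T' x)) + gh1 A (T (swap0 x) + swap0 (T' x))).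
    rewrite -[LHS]/(T (h' x + gh0 A (swap0 x)) + (h (T' x) + gh1 A (swap0 (T' x)))).
    rewrite (linearD T) (linearD (gh1 A)) addrACA; congr (_ + (_ + _)).
    exact: (esym (ghom_tau01 A (swap0 x))).
  rewrite [X in gh1 A X](swap0_homotopy (N := parity_shift M) x) linearB /= s1 addrA.
  congr (_ - _).
  by rewrite A1 defect_t // defectE // addrC addrNK.
- move=> x; have [n xn] := polmap2_nil gt0_nil gt1_nil x; exists n.
  by rewrite -[RHS]xn; apply: eq_iter => y; exact: s0.
- move=> x; have [n xn] := polmap2_nil gt1_nil gt0_nil x; exists n.
  by rewrite -[RHS]xn; apply: eq_iter => y; exact: s1.
Qed.

End SyzygyFlat.

(** * The flat resolution *)

Section FlatResolution.
Variables (k : fieldType) (p : nat).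

Definition gmod0 : gmod k p.
Proof.
exists ('rV[k]_0 : lmodType k) ('rV[k]_0 : lmodType k) idfun idfun idfun idfun;
  by move=> x; rewrite [LHS]thinmx0 [RHS]thinmx0.
Defined.

Lemma gmod0_eq0 (x : gtot gmod0) : x = 0.
Proof. by case: x => a b; congr (_, _); exact: thinmx0. Qed.

Lemma gmod0_flat : flat gmod0.
Proof.
move=> N1 N2 f _ s _; have [W [tp [btp tpP]]] := tensor_exists N1 gmod0.
apply/tpP; rewrite /feval big1 // => x _; rewrite (gmod0_eq0 x.2.2).
by have := balZr btp 0 x.2.1 0; rewrite !scale0r => ->; rewrite scaler0.
Qed.

Lemma zero_linear (U V : lmodType k) : linear (fun _ : U => 0 : V).
Proof. by move=> c x y; rewrite scaler0 addr0. Qed.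

Definition ghom0 (M N : gmod k p) : ghom M N.
Proof.
exists (mklin (@zero_linear (gm0 M) (gm0 N)))
  (mklin (@zero_linear (gm1 M) (gm1 N))); by move=> x; rewrite /= linear0.
Defined.

Lemma ghom0E M N x : ghtot (ghom0 M N) x = 0.
Proof. by []. Qed.

Section Augmentation.
Variable M : gmod k p.
Local Notation op := (@parity_shift k p).

Definition aug (N : gmod k p) (x : (pol (gm0 N) * pol (gm1 N))%type) : gm0 N :=
  pev (gt0 N) x.1 + gtau10 N (pev (gt1 N) x.2).

Lemma aug_linear N : linear (@aug N).
Proof. by move=> c x y; rewrite /aug /= !linearP scalerDr addrACA. Qed.

Lemma aug_t N x : aug (N := N) (ind_t x) = gt0 N (aug x).
Proof. by rewrite /aug /= !pev_X gcomm_1 linearD. Qed.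

Lemma aug_tau N x : aug (N := op N) (ind_tau p x) = gtau01 N (aug x).
Proof. by rewrite /aug /= pev_iterX linearD gtau2_1 addrC. Qed.

Definition augmentation : ghom (induced p (gm0 M) (gm1 M)) M.
Proof.
exists (mklin (@aug_linear M)) (mklin (@aug_linear (op M))).
- exact: aug_t.
- exact: (aug_t (N := op M)).
- by move=> x; apply/esym; apply: (esym (aug_tau _)).
- by move=> x; apply/esym; apply: (esym (aug_tau (N := op M) _)).
Defined.

(** The element (t - t_M) x + (tau - tau_M) y rewritten in the coordinates a + tau b of the induced
    module. *)
Definition syz_incl (N : gmod k p) (x : (pol (gm0 N) * pol (gm1 N))%type)
    : (pol (gm0 N) * pol (gm1 N))%type :=
  (pXs (gt0 N) x.1 - polmap (gtau10 N) x.2, x.2).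

Lemma syz_incl_linear N : linear (@syz_incl N).
Proof.
move=> c x y; rewrite /syz_incl /= !linearP /=.
by congr (_, _); rewrite /= [in RHS]scalerDr [LHS]addrACA.
Qed.

Lemma syz_incl_t N x : syz_incl (N := N) (ind_t x) = ind_t (syz_incl x).
Proof.
rewrite /syz_incl /ind_t /= polmap_X linearB /=; congr (_ - _, _).
by rewrite /pXs polmap_X linearB.
Qed.

Lemma syz_incl_tau N x :
  syz_incl (N := op N) (syz_tau x) = ind_tau p (syz_incl (N := N) x).
Proof.
rewrite /ind_tau /syz_incl /=; congr (_, _).
by have := congr1 snd (syz_tau2 x); rewrite iter_ind_t.
Qed.

Definition syzygy_map : ghom (syz M) (induced p (gm0 M) (gm1 M)).
Proof.
exists (mklin (@syz_incl_linear M)) (mklin (@syz_incl_linear (op M))).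
- exact: syz_incl_t.
- exact: (syz_incl_t (N := op M)).
- exact: syz_incl_tau.
- exact: (syz_incl_tau (N := op M)).
Defined.

Lemma aug_surj N (u : gm0 N) : exists x, aug (N := N) x = u.
Proof. by exists (pC u, 0); rewrite /aug /= pev_C !linear0 addr0. Qed.

Lemma aug_syz_incl N x : aug (N := N) (syz_incl x) = 0.
Proof.
rewrite /aug /syz_incl /= linearB /= pev_pXs.
by rewrite (pev_polmap (@gcomm_1 k p N)) add0r addNr.
Qed.

(** Since a + tau b = (a + tau_M b) + (tau - tau_M) b, only a + tau_M b remains to be treated. It is
    a polynomial over the even part whose value at t_M is zero, hence divisible by t - t_M. *)
Lemma aug_exact N x : aug (N := N) x = 0 -> exists y, syz_incl (N := N) y = x.
Proof.
case: x => a b; rewrite /aug /= => E.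
have [h hE] := pXs_ker_pev (gt0 N) (a + polmap (gtau10 N) b).
exists (h, b); rewrite /syz_incl /=; congr (_, _).
move: hE; rewrite linearD /= (pev_polmap (@gcomm_1 k p N)) E linear0 add0r => <-.
by rewrite addrK.
Qed.

Lemma syz_incl_inj N x : syz_incl (N := N) x = 0 -> x = 0.
Proof.
case: x => a b E; have b0 : b = 0 := congr1 snd E.
have := congr1 fst E; rewrite /syz_incl /= b0 linear0 subr0 => /pXs_inj ->.
by [].
Qed.

Definition res_obj (i : nat) : gmod k p :=
  match i with 0 => induced p (gm0 M) (gm1 M) | 1 => syz M | _ => gmod0 end.

Definition res_map (i : nat) : ghom (res_obj i.+1) (res_obj i) :=
  match i with 0 => syzygy_map | _ => ghom0 _ _ end.

Hypothesis p_gt0 : (0 < p)%N.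
Hypothesis hnil : forall x : gtot M, exists n, iter n (@act_t k p M) x = 0.

Lemma max_image_fin_flat_dim : max_image (@mf k p M) -> fin_flat_dim M.
Proof.
(* The resolution has length 1, so finite flat dimension here already means flat dimension at most
   1. *)
move=> mM; exists 1%N, res_obj, res_map, augmentation; split; last split; last split;
  last split.
- case=> [|[|i]]; [exact: induced_flat|exact: syz_flat|exact: gmod0_flat].
- by case=> [|[|i]] // _ x; exact: gmod0_eq0.
- move=> [u v]; have [x xu] := aug_surj u; have [y yv] := aug_surj (N := op M) v.
  by exists (x, y); congr (_, _).
- move=> [x y]; split=> [E|[[z w] <-]].
    have [z zE] := aug_exact (congr1 fst E).
    have [w wE] := aug_exact (N := op M) (congr1 snd E).
    by exists (z, w); exact: (congr2 pair zE wE).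
  by congr (_, _); [exact: aug_syz_incl|exact: (aug_syz_incl (N := op M))].
- case=> [|i] x; split=> [E|[y <-]].
  + exists 0; rewrite [LHS]ghom0E; case: x E => x y E.
    exact: (esym (congr2 pair (syz_incl_inj (congr1 fst E))
      (syz_incl_inj (N := op M) (congr1 snd E)))).
  + by rewrite [ghtot (res_map 1) y]ghom0E linear0.
  + by exists 0; rewrite [LHS]ghom0E; apply/esym; exact: gmod0_eq0.
  + exact: ghom0E.
Qed.

End Augmentation.

End FlatResolution.

(** * Ranks *)

Section Dimension.
Variable k : fieldType.

Lemma spans_family (V : lmodType k) (P : V -> Prop) n (g : 'I_n -> V) :
  (forall i, P (g i)) ->
  (forall v, P v -> exists c : 'I_n -> k, v = \sum_(i < n) c i *: g i) ->
  exists s, size s = n /\ spans P s.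
Proof.
move=> Pg gen; pose s := [seq g i | i <- enum 'I_n].
have sz : size s = n by rewrite size_map size_enum_ord.
have snth (i : 'I_n) : s`_i = g i.
  by rewrite (nth_map i) ?nth_ord_enum // size_enum_ord.
exists s; split=> //; split=> [i|v /gen[c ->]].
  by rewrite sz => lin; rewrite -[i]/(val (Ordinal lin)) snth.
pose c' j := if insub j is Some i then c i else 0.
exists (c' \o val); rewrite /= -(big_mkord predT (fun i => c' i *: s`_i)) sz big_mkord.
by apply: eq_bigr => i _; rewrite snth /c' valK.
Qed.

Lemma linear_row_sum (V : lmodType k) m n (phi : {linear 'rV[k]_n -> V})
    (D : 'rV_m) (B : 'M_(m, n)) :
  phi (D *m B) = \sum_(i < m) D 0 i *: phi (row i B).
Proof.
by rewrite mulmx_sum_row linear_sum; apply: eq_bigr => i _; rewrite linearZ.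
Qed.

(** Injectivity comes from minimality of [d]: given a nonzero linear relation [c] among the spanning
    vectors, the images of a basis of a complement of the line through [c] would span [V] with only
    d - 1 vectors. *)
Lemma dimP_coordinates (V : lmodType k) d : dimP (fun _ : V => True) d ->
  exists phi : {linear 'rV[k]_d -> V}, injective phi /\ forall v, exists u, phi u = v.
Proof.
move=> [[s [<- [_ gen]]] mins].
have lphi : linear (fun u : 'rV[k]_(size s) => \sum_(i < size s) u 0 i *: s`_i).
  move=> a u v; rewrite scaler_sumr -big_split; apply: eq_bigr => i _ /=.
  by rewrite !mxE scalerDl scalerA.
have [phi phiE] : exists phi : {linear 'rV[k]_(size s) -> V},
    forall u, phi u = \sum_(i < size s) u 0 i *: s`_i by exists (mklin lphi).
have surj v : exists u, phi u = v.
  have [c ->] := gen v I; exists (\row_i c i); rewrite phiE.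
  by apply: eq_bigr => i _; rewrite mxE.
exists phi; split=> // u v uv; apply/eqP; rewrite -subr_eq0; apply/eqP.
have {uv} : phi (u - v) = 0 by rewrite linearB uv subrr.
move: (u - v) => c c0; apply/eqP; apply: contraT => cn0.
have [|v' _|s' [sz sp]] := @spans_family V (fun _ => True) _
    (fun i => phi (row i (row_base (c^C)%MS))).
- by [].
- have [w <-] := surj v'.
  have /sub_addsmxP[[u1 u2] /= ->] : (w <= c + c^C)%MS.
    by rewrite submx_full // addsmx_compl_full.
  have /submxP[D ->] : (u2 *m c^C <= row_base (c^C))%MS.
    by rewrite eq_row_base submxMl.
  exists (D 0); rewrite linearD !linear_row_sum big_ord1.
  by rewrite (_ : row 0 c = c) ?c0 ?scaler0 ?add0r //; apply/rowP => j; rewrite mxE.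
- have s_gt0 : (0 < size s)%N.
    by apply: leq_trans (rank_leq_col c); rewrite rank_rV cn0.
  by have := mins _ sp; rewrite sz mxrank_compl rank_rV cn0 leqNgt ltn_subrL s_gt0.
Qed.

Lemma dimP_image (W : lmodType k) n (P : W -> Prop) (phi : {linear 'rV[k]_n -> W})
    (B : 'M[k]_n) : injective phi ->
  (forall w, P w <-> exists u, w = phi (u *m B)) -> dimP P (\rank B).
Proof.
move=> inj PE; split.
  apply: (@spans_family W P _ (fun i => phi (row i (row_base B)))).
    move=> i; apply/PE.
    have /submxP[D ->] : (row i (row_base B) <= B)%MS.
      by rewrite -(eq_row_base B) row_sub.
    by exists D.
  move=> w /PE[u ->].
  have /submxP[D ->] : (u *m B <= row_base B)%MS by rewrite eq_row_base submxMl.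
  by exists (D 0); rewrite linear_row_sum.
move=> s [Ps gen].
have [U UE] : exists U : 'I_(size s) -> 'rV[k]_n, forall i : 'I_(size s), s`_i = phi (U i *m B).
  have U0 (i : 'I_(size s)) : exists u, s`_i = phi (u *m B) by apply/PE; exact: Ps.
  by have [U UE] := choice U0; exists U.
suff /mxrankS le : (B <= \matrix_i (U i *m B))%MS.
  exact: leq_trans le (rank_leq_row _).
apply/row_subP => j.
have [|c cE] := gen (phi (row j B)).
  by apply/PE; exists (delta_mx 0 j); rewrite -rowE.
apply/submxP; exists (\row_i c i); apply: inj.
rewrite cE linear_row_sum; apply: eq_bigr => i _.
by rewrite mxE rowK UE.
Qed.

(** In coordinates [f] is a square matrix of size 2d whose image lies in its kernel, so its rank is
    at most 2d minus itself. Hence the rank is at most d, with equality exactly when image and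
    kernel have the same dimension and therefore coincide. *)
Lemma square_zero_rank (V : lmodType k) d
    (f : {linear (V * V)%type -> (V * V)%type}) :
  (forall z, f (f z) = 0) -> dimP (fun _ : V => True) d ->
  exists r, dimP (fun z => exists w, f w = z) r /\
    (max_image f <-> r = d) /\ (r <= d)%N.
Proof.
move=> ff /dimP_coordinates[phi [injphi surjphi]].
have lPhi : linear (fun u : 'rV[k]_(d + d) => (phi (lsubmx u), phi (rsubmx u))).
  by move=> a u v; rewrite !linearP.
pose Phi : {linear 'rV[k]_(d + d) -> (V * V)%type} := mklin lPhi.
have injPhi : injective Phi.
  by move=> u v [/injphi ul /injphi ur]; rewrite -[u]hsubmxK ul ur hsubmxK.
have surjPhi z : exists u, Phi u = z.
  have [u1 u1E] := surjphi z.1; have [u2 u2E] := surjphi z.2.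
  by exists (row_mx u1 u2); rewrite /= row_mxKl row_mxKr u1E u2E; case: z {u1E u2E}.
have [Psi PsiK] := linear_retraction injPhi.
have PhiK z : Phi (Psi z) = z by have [u <-] := surjPhi z; rewrite PsiK.
have lF : linear (fun u => Psi (f (Phi u))) by move=> a u v; rewrite !linearP.
pose B := lin1_mx (mklin lF).
have BE u : Phi (u *m B) = f (Phi u) by rewrite mul_rV_lin1 PhiK.
have BB : (B <= kermx B)%MS.
  apply/sub_kermxP/row_matrixP => i; rewrite row0 rowE mulmxA; apply: injPhi.
  by rewrite !BE ff linear0.
have rk : (\rank (kermx B) = d + d - \rank B)%N by rewrite mxrank_ker.
have rB : (\rank B <= d + d)%N := rank_leq_row B.
have := mxrankS BB; rewrite rk => le1.
have le2 : (\rank B <= d)%N.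
  by rewrite -leq_double -!addnn; rewrite -(leq_add2r (\rank B)) subnK in le1.
exists (\rank B); split; last split => //.
  apply: (dimP_image injPhi) => w; split=> [[z <-]|[u ->]].
    by exists (Psi z); rewrite BE PhiK.
  by exists (Phi u); rewrite BE.
split=> [mf|rd].
  apply/eqP; rewrite eqn_leq le2 /=.
  have kB : (kermx B <= B)%MS.
    apply/row_subP => i.
    have : f (Phi (row i (kermx B))) = 0.
      by rewrite -BE (sub_kermxP (row_sub i _)) linear0.
    move=> /mf[w wE]; apply/submxP; exists (Psi w); apply: injPhi.
    by rewrite BE PhiK.
  have := mxrankS kB; rewrite rk leq_subLR -(leq_add2r d) => le3.
  by rewrite -leq_double -!addnn; rewrite leq_add2r in le3.
move=> z; split=> [fz|[w <-]]; last exact: ff.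
have kB : (B == kermx B)%MS.
  by rewrite -(mxrank_leqif_eq BB) rk rd addnK.
have : (Psi z <= B)%MS.
  rewrite (eqmxP kB); apply/sub_kermxP; apply: injPhi.
  by rewrite BE PhiK fz linear0.
by move=> /submxP[D DE]; exists (Phi D); rewrite -BE -DE PhiK.
Qed.

End Dimension.

Theorem mainTheorem2 (k : fieldType) (p : nat)
  (hchar : p \in [pchar k]) (hp3 : (3 <= p)%N)
  (M : gmod k p)
  (hnil : forall x : gtot M, exists n, iter n (@act_t k p M) x = 0) :
  (forall z, mf (mf z) = 0 :> gtot M * gtot M)
  /\ (fin_flat_dim M <-> max_image (@mf k p M))
  /\ (forall d, dimP (fun _ : gtot M => True) d ->
        exists r, dimP (fun z : gtot M * gtot M => exists w, mf w = z) r
          /\ (fin_flat_dim M <-> r = d)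
          /\ (~ fin_flat_dim M -> (r < d)%N)).
Proof.
have p_gt0 : (0 < p)%N by apply: leq_trans hp3.
have ffdE : fin_flat_dim M <-> max_image (@mf k p M).
  split; first exact: fin_flat_dim_max_image.
  exact: max_image_fin_flat_dim.
split; first exact: mf_mf.
split=> // d dM; have [r [dr [mr rd]]] := square_zero_rank (mf_mf p_gt0) dM.
exists r; split=> //; rewrite ffdE; split=> // nf.
by rewrite ltn_neqAle rd andbT; apply/eqP => /mr.
Qed.
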